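(* Let $W=W(\Gamma,\mathbf m)$ be a graph product of primary cyclic groups. If $W$ is a one-ended word hyperbolic group, then the outer automorphism group $\operatorname{Aut}W/\operatorname{Inn}W$ is finite.
   Context: $\Gamma$ is a finite simplicial graph with non-empty vertex set $V=\{v_1,\dots,v_N\}$. Each index $i$ is given a label $\mathbf m(i)$ which is a prime power $p^\alpha$, $\alpha\ge1$. The graph product of primary cyclic groups $W=W(\Gamma,\mathbf m)$ is the group with generators $V$ and relations $v_i^{\mathbf m(i)}=1$ and $v_jv_k=v_kv_j$ whenever $v_j,v_k$ are adjacent in $\Gamma$. *)

(* Defs.v *)
From HB Require Import structures.
From mathcomp Require Import all_boot all_order all_algebra.
From mathcomp Require Import all_classical.

Set Implicit Arguments.
Unset Strict Implicit.
Unset Printing Implicit Defensive.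

Import Order.TTheory GRing.Theory Num.Theory.

Local Open Scope classical_set_scope.
Local Open Scope group_scope.

(* A letter (x, b) stands for x when b = false and for x^-1 when b = true. *)
Definition word (X : Type) := seq (X * bool).

Definition winv (X : Type) (w : word X) : word X :=
  rev [seq (l.1, ~~ l.2) | l <- w].

Definition weval (X : Type) (G : groupType) (f : X -> G) (w : word X) : G :=
  \prod_(l <- w) (if l.2 then (f l.1)^-1 else f l.1).

Section Presentation.
Variables (X : choiceType) (R : word X -> word X -> Prop).

(* The congruence on words whose quotient is the group < X | u = v, R u v >. *)
Inductive pres_eq : word X -> word X -> Prop :=
| pres_eq_refl w : pres_eq w w
| pres_eq_sym w1 w2 : pres_eq w1 w2 -> pres_eq w2 w1
| pres_eq_trans w1 w2 w3 : pres_eq w1 w2 -> pres_eq w2 w3 -> pres_eq w1 w3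
| pres_eq_cancel u v x b : pres_eq (u ++ [:: (x, b); (x, ~~ b)] ++ v) (u ++ v)
| pres_eq_rel u v l r : R l r -> pres_eq (u ++ l ++ v) (u ++ r ++ v).

Definition pres_eqb (u v : word X) : bool := `[< pres_eq u v >].

Lemma pres_eqb_refl : reflexive pres_eqb.
Proof. by move=> w; apply/asboolP; exact: pres_eq_refl. Qed.

Lemma pres_eqb_sym : symmetric pres_eqb.
Proof. by move=> u v; apply/asboolP/asboolP; exact: pres_eq_sym. Qed.

Lemma pres_eqb_trans : transitive pres_eqb.
Proof.
move=> v u w /asboolP uv /asboolP vw; apply/asboolP.
exact: pres_eq_trans uv vw.
Qed.

Canonical pres_equiv := EquivRel pres_eqb pres_eqb_refl pres_eqb_sym
  pres_eqb_trans.

Definition presented := {eq_quot pres_equiv}%qT.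

HB.instance Definition _ := Choice.on presented.

Definition pclass (w : word X) : presented := \pi_presented%qT w.

Lemma pclassP u v : pclass u = pclass v <-> pres_eq u v.
Proof.
rewrite /pclass; split => [/eqquotP/asboolP //|uv].
by apply/eqquotP/asboolP.
Qed.

Lemma pclass_repr (g : presented) : pclass (repr g) = g.
Proof. exact: reprK. Qed.

Lemma pres_eq_catl u v w : pres_eq u v -> pres_eq (w ++ u) (w ++ v).
Proof.
elim=> [a|a b _|a b c _ ab _ bc|a b x e|a b l r lr].
- exact: pres_eq_refl.
- exact: pres_eq_sym.
- exact: pres_eq_trans ab bc.
- by rewrite !(catA w); exact: pres_eq_cancel.
- by rewrite !(catA w); exact: pres_eq_rel.
Qed.

Lemma pres_eq_catr u v w : pres_eq u v -> pres_eq (u ++ w) (v ++ w).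
Proof.
elim=> [a|a b _|a b c _ ab _ bc|a b x e|a b l r lr].
- exact: pres_eq_refl.
- exact: pres_eq_sym.
- exact: pres_eq_trans ab bc.
- by rewrite -!catA; exact: pres_eq_cancel.
- by rewrite -!catA; exact: pres_eq_rel.
Qed.

Lemma pres_eq_cat u u' v v' :
  pres_eq u u' -> pres_eq v v' -> pres_eq (u ++ v) (u' ++ v').
Proof.
move=> uu vv; apply: pres_eq_trans (pres_eq_catr _ uu) _.
exact: pres_eq_catl.
Qed.

Lemma winvK : involutive (@winv X).
Proof.
move=> w; rewrite /winv map_rev revK -map_comp -[RHS]map_id.
by apply: eq_map => -[x b] /=; rewrite negbK.
Qed.

Lemma pres_eq_winvr w : pres_eq (w ++ winv w) [::].
Proof.
elim: w => [|[x b] w IH]; first exact: pres_eq_refl.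
rewrite /winv /= rev_cons -cats1 -/(winv w).
have -> : (x, b) :: w ++ winv w ++ [:: (x, ~~ b)] =
  [:: (x, b)] ++ (w ++ winv w) ++ [:: (x, ~~ b)] by rewrite /= catA.
apply: pres_eq_trans (pres_eq_catl _ (pres_eq_catr _ IH)) _.
exact: (pres_eq_cancel [::] [::]).
Qed.

Lemma pres_eq_winvl w : pres_eq (winv w ++ w) [::].
Proof. by rewrite -{2}[w]winvK; exact: pres_eq_winvr. Qed.

Lemma pres_eq_winv u v : pres_eq u v -> pres_eq (winv u) (winv v).
Proof.
move=> uv.
have H1 : pres_eq (winv u) (winv u ++ v ++ winv v).
  apply: pres_eq_sym; rewrite -[X in pres_eq _ X]cats0.
  exact: pres_eq_catl (pres_eq_winvr v).
apply: pres_eq_trans H1 _; rewrite catA -[X in pres_eq _ X]cat0s.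
apply: pres_eq_catr; apply: pres_eq_trans (pres_eq_winvl u).
exact/pres_eq_catl/pres_eq_sym.
Qed.

Definition pres_one : presented := pclass [::].
Definition pres_mul (g h : presented) : presented := pclass (repr g ++ repr h).
Definition pres_inv (g : presented) : presented := pclass (winv (repr g)).

Lemma pres_repr w : pres_eq (repr (pclass w)) w.
Proof. by apply/pclassP; rewrite pclass_repr. Qed.

Lemma pclass_mul u v : pres_mul (pclass u) (pclass v) = pclass (u ++ v).
Proof. by apply/pclassP; apply: pres_eq_cat; exact: pres_repr. Qed.

Lemma pclass_inv u : pres_inv (pclass u) = pclass (winv u).
Proof. by apply/pclassP/pres_eq_winv; exact: pres_repr. Qed.

Lemma pres_mulA : associative pres_mul.
Proof.
move=> a b c; rewrite -(pclass_repr a) -(pclass_repr b) -(pclass_repr c).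
by rewrite !pclass_mul catA.
Qed.

Lemma pres_mul1 : left_id pres_one pres_mul.
Proof. by move=> a; rewrite -(pclass_repr a) pclass_mul. Qed.

Lemma pres_mulr1 : right_id pres_one pres_mul.
Proof. by move=> a; rewrite -(pclass_repr a) pclass_mul cats0. Qed.

Lemma pres_mulV : left_inverse pres_one pres_inv pres_mul.
Proof.
move=> a; rewrite -(pclass_repr a) pclass_inv pclass_mul.
exact/pclassP/pres_eq_winvl.
Qed.

Lemma pres_mulrV : right_inverse pres_one pres_inv pres_mul.
Proof.
move=> a; rewrite -(pclass_repr a) pclass_inv pclass_mul.
exact/pclassP/pres_eq_winvr.
Qed.

HB.instance Definition _ := isGroup.Build presented
  pres_mulA pres_mul1 pres_mulr1 pres_mulV pres_mulrV.

End Presentation.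

Inductive graph_product_rel (N : nat) (e : rel 'I_N) (m : 'I_N -> nat) :
  word 'I_N -> word 'I_N -> Prop :=
| gp_order i : graph_product_rel e m (nseq (m i) (i, false)) [::]
| gp_comm j k : e j k ->
    graph_product_rel e m [:: (j, false); (k, false)]
                          [:: (k, false); (j, false)].

Definition graph_product (N : nat) (e : rel 'I_N) (m : 'I_N -> nat)
  : groupType := presented (graph_product_rel e m).

Definition prime_power (n : nat) : Prop :=
  exists p a : nat, [/\ prime p, (1 <= a)%N & n = (p ^ a)%N].

Section CayleyGraph.
Variables (G : groupType) (S : seq G).

Definition word_for (g : G) (w : word G) : Prop :=
  all (fun l => l.1 \in S) w /\ weval id w = g.

Definition generates : Prop := forall g, exists w, word_for g w.

(* Junk value 0 when g is not in the subgroup generated by S. *)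
Definition word_length (g : G) : nat :=
  if pselect (exists n, `[< exists w, word_for g w /\ size w = n >]) is left h
  then ex_minn h else 0%N.

Definition word_dist (x y : G) : nat := word_length (x^-1 * y).

Definition gromov_product (x y w : G) : rat :=
  (((word_dist x w)%:R + (word_dist y w)%:R - (word_dist x y)%:R) / 2%:R)%R.

Definition gromov_hyperbolic (delta : rat) : Prop :=
  forall x y z w : G,
    (Num.min (gromov_product x y w) (gromov_product y z w) - delta
       <= gromov_product x z w)%R.

Definition cayley_adj : rel G :=
  fun x y => (x^-1 * y \in S) || (y^-1 * x \in S).

(* Vertices of the component of x in the Cayley graph with F removed. *)
Definition component_off (F : set G) (x : G) : set G :=
  [set y | exists p : seq G, [/\ path cayley_adj x p, last x p = y &
                               forall z, z \in x :: p -> ~ F z]].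

Definition infinite_components_off (F : set G) : set (set G) :=
  [set C | infinite_set C /\ exists2 x, ~ F x & C = component_off F x].

(* The supremum, over finite vertex sets F, of the number of infinite
   components of the complement of F is n. *)
Definition number_of_ends (n : nat) : Prop :=
  (forall F : set G, finite_set F ->
     (infinite_components_off F #<= `I_n)%card) /\
  (exists2 F : set G, finite_set F &
     (infinite_components_off F #= `I_n)%card).

End CayleyGraph.

Definition word_hyperbolic (G : groupType) : Prop :=
  exists2 S : seq G, generates S & exists delta, gromov_hyperbolic S delta.

Definition one_ended (G : groupType) : Prop :=
  exists2 S : seq G, generates S & number_of_ends S 1%N.

Section Automorphisms.
Variable G : groupType.

Record Aut := MkAut {
  aut_fun :> G -> G;
  aut_morph : {morph aut_fun : x y / x * y};
  aut_bij : bijective aut_fun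
}.

Lemma autP (f g : Aut) : f =1 g -> f = g.
Proof.
case: f g => f fM fB [g gM gB] /= /funext fg; case: g / fg in gM gB *.
by congr MkAut; exact: Prop_irrelevance.
Qed.

HB.instance Definition _ := gen_eqMixin Aut.
HB.instance Definition _ := gen_choiceMixin Aut.

Lemma idM : {morph @id G : x y / x * y}. Proof. by []. Qed.

Definition aut_one : Aut := MkAut idM (Bijective (frefl _) (frefl _)).

Lemma aut_compM (f g : Aut) : {morph f \o g : x y / x * y}.
Proof. by move=> x y /=; rewrite !aut_morph. Qed.

Definition aut_mul (f g : Aut) : Aut :=
  MkAut (aut_compM f g) (bij_comp (aut_bij f) (aut_bij g)).

Lemma aut_inv_ex (f : Aut) : exists g : G -> G, cancel f g /\ cancel g f.
Proof. by case: (aut_bij f) => g; exists g. Qed.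

Definition aut_invf (f : Aut) : G -> G := projT1 (cid (aut_inv_ex f)).

Lemma aut_invK (f : Aut) : cancel f (aut_invf f).
Proof. by rewrite /aut_invf; case: cid => g []. Qed.

Lemma aut_Kinv (f : Aut) : cancel (aut_invf f) f.
Proof. by rewrite /aut_invf; case: cid => g []. Qed.

Lemma aut_invM (f : Aut) : {morph aut_invf f : x y / x * y}.
Proof.
by move=> x y; apply: (can_inj (aut_invK f)); rewrite aut_morph !aut_Kinv.
Qed.

Definition aut_inv (f : Aut) : Aut :=
  MkAut (@aut_invM f) (Bijective (aut_Kinv f) (aut_invK f)).

Lemma aut_mulA : associative aut_mul.
Proof. by move=> f g h; exact: autP. Qed.

Lemma aut_mul1 : left_id aut_one aut_mul.
Proof. by move=> f; exact: autP. Qed.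

Lemma aut_mulr1 : right_id aut_one aut_mul.
Proof. by move=> f; exact: autP. Qed.

Lemma aut_mulV : left_inverse aut_one aut_inv aut_mul.
Proof. by move=> f; apply: autP => x /=; rewrite aut_invK. Qed.

Lemma aut_mulrV : right_inverse aut_one aut_inv aut_mul.
Proof. by move=> f; apply: autP => x /=; rewrite aut_Kinv. Qed.

HB.instance Definition _ := isGroup.Build Aut
  aut_mulA aut_mul1 aut_mulr1 aut_mulV aut_mulrV.

Definition inner_fun (g x : G) : G := g * x * g^-1.

Lemma inner_funM g : {morph inner_fun g : x y / x * y}.
Proof. by move=> x y; rewrite /inner_fun !mulgA -(mulgA (g * x) g^-1 g) mulVg mulg1. Qed.

Lemma inner_fun_bij g : bijective (inner_fun g).
Proof.
by exists (inner_fun g^-1) => x;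
  rewrite /inner_fun invgK !mulgA ?mulVg ?mulgV mul1g -mulgA ?mulVg ?mulgV mulg1.
Qed.

Definition inner (g : G) : Aut := MkAut (@inner_funM g) (inner_fun_bij g).

Definition Inn : set Aut := range inner.

(* The set Aut G / Inn G of left cosets of Inn G. *)
Definition Out : set (set Aut) :=
  [set [set phi * i | i in Inn] | phi in [set: Aut]].

End Automorphisms.

Arguments Inn G : clear implicits.
Arguments Out G : clear implicits.

(* Main.v *)
(* Write [W] for the graph product.  A hyperplane of [W] is a vertex [x] together
   with a coset [h * sub (star x)]; it cuts [W] into [m x] sectors, permuted by
   the rotation [h * gen x * h^-1], which determines the hyperplane.

   Elements of finite order are conjugate into the finite subgroups spanned by
   cliques, so up to finite index an automorphism [phi] maps each generator
   [gen i] to a conjugate [g i * gen i * (g i)^-1], i.e. to a rotation around a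
   hyperplane [H i].  Choose a point [p] and paths from [p] to the carriers of
   the [H i] of minimal total length.  Let [J] be a hyperplane crossed by one of
   these paths, and let [C] be the set of the [i] such that the rotation [r]
   around [J] commutes with [phi (gen i)].  The [H i] with [i] outside [C] lie in
   sectors of [J], and in the same sector when [i] and [j] are adjacent.  If all
   of them lie in one sector, folding everything into this sector by rotations
   around [J] shortens the paths: contradiction.  Hence [C] separates the graph,
   and as [W] is one-ended, [C] is not a clique.  So [phi^-1 r] centralizes two
   nonadjacent generators; as [W] is hyperbolic, the graph has no induced square
   and this centralizer lies in a finite clique subgroup.  Therefore the number
   of such [J], hence the length of the paths, is bounded independently of
   [phi], which leaves finitely many possibilities for [phi] modulo [Inn W]. *)
Require Import Defs.
From mathcomp Require Import all_boot all_order all_algebra.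
From mathcomp Require Import all_classical.
From mathcomp Require Import ring lra zify.

Set Implicit Arguments.
Unset Strict Implicit.
Unset Printing Implicit Defensive.

Import Order.TTheory GRing.Theory Num.Theory.

Local Open Scope group_scope.

(** * Homomorphisms out of a group given by a presentation *)

Section PresentedGroup.
Variables (X : choiceType) (R : word X -> word X -> Prop).
Local Notation G := (presented R).

Lemma pclassM (u v : word X) : pclass R (u ++ v) = pclass R u * pclass R v.
Proof. exact/esym/pclass_mul. Qed.

Lemma pclassV (u : word X) : pclass R (winv u) = (pclass R u)^-1.
Proof. exact/esym/pclass_inv. Qed.

Lemma pclass_nil : pclass R [::] = 1. Proof. by []. Qed.

Lemma pclass_cons x b (w : word X) :
  pclass R ((x, b) :: w) =
  (if b then (pclass R [:: (x, false)])^-1 else pclass R [:: (x, false)])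
  * pclass R w.
Proof. by rewrite -cat1s pclassM; case: b; rewrite // -pclassV. Qed.

Lemma weval_cat (H : groupType) (f : X -> H) u v :
  weval f (u ++ v) = weval f u * weval f v.
Proof. by rewrite /weval big_cat. Qed.

Lemma weval_pres_eq (H : groupType) (f : X -> H) :
    (forall l r, R l r -> weval f l = weval f r) ->
  forall u v, pres_eq R u v -> weval f u = weval f v.
Proof.
move=> fR u v; elim=> {u v} [//|u v _ ->//|u v w _ -> _ ->//|u v x b|u v l r lr].
  rewrite !weval_cat; congr (_ * _); rewrite /weval !big_cons big_nil /=.
  by case: b; rewrite !gsimp.
by rewrite !weval_cat (fR _ _ lr).
Qed.

Lemma pres_hom_ex (H : groupType) (f : X -> H) :
    (forall l r, R l r -> weval f l = weval f r) ->
  exists2 F : G -> H, {morph F : x y / x * y} &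
    forall x, F (pclass R [:: (x, false)]) = f x.
Proof.
move=> fR; have fE := weval_pres_eq fR.
have FE w : weval f (repr (pclass R w)) = weval f w by exact/fE/pres_repr.
exists (fun g : G => weval f (repr g)) => [g h|x].
  rewrite -[g in LHS]pclass_repr -[h in LHS]pclass_repr -pclassM FE.
  exact: weval_cat.
by rewrite FE /weval big_seq1.
Qed.

End PresentedGroup.

Lemma morph1g (G H : groupType) (f : G -> H) :
  {morph f : x y / x * y} -> f 1 = 1.
Proof. by move=> fM; apply: (mulgI (f 1)); rewrite -fM !mulg1. Qed.

Lemma morphVg (G H : groupType) (f : G -> H) :
  {morph f : x y / x * y} -> {morph f : x / x^-1}.
Proof. by move=> fM x; apply: (mulgI (f x)); rewrite -fM !mulgV morph1g. Qed.

Lemma morphXg (G H : groupType) (f : G -> H) n :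
  {morph f : x y / x * y} -> {morph f : x / x ^+ n}.
Proof.
by move=> fM x; elim: n => [|n IH]; rewrite ?expg0 ?morph1g// !expgS fM IH.
Qed.

Lemma commute_conj (G : groupType) (x y h : G) :
  commute x y -> commute (h * x * h^-1) (h * y * h^-1).
Proof. by move=> xy; rewrite /commute !mulgA !mulgVK -!(mulgA h) xy. Qed.

(** * Automorphisms modulo inner automorphisms *)

Lemma aut_commute (G : groupType) (phi : Aut G) x y : commute (phi x) (phi y) <-> commute x y.
Proof.
split=> [|xy]; rewrite /commute -!aut_morph; last by rewrite xy.
exact: (bij_inj (aut_bij phi)).
Qed.

Lemma aut_innerE (G : groupType) (phi : Aut G) g x :
  (phi * inner g) x = phi g * phi x * (phi g)^-1.
Proof.
rewrite -[LHS]/(phi (g * x * g^-1)) !(aut_morph phi).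
by rewrite (morphVg (aut_morph phi)).
Qed.

Lemma witness_fun (T F : Type) (t0 : T) (P : T -> F -> Prop) :
  exists rep : F -> T, forall k t, P t k -> P (rep k) k.
Proof.
suff /choice[rep repP] k : exists r, forall t, P t k -> P r k by exists rep.
have [[t pt]|nP] := pselect (exists t, P t k); first by exists t.
by exists t0 => t pt; case: nP; exists t.
Qed.

(** Read [P phi k] as: [k] is a key of [phi]. Every coset of [Inn G] is that of the automorphism
    chosen for one of the finitely many keys. *)
Lemma finite_Out_key (G : groupType) (F : finType) (P : Aut G -> F -> Prop) :
    (forall phi, exists k, P phi k) ->
    (forall phi psi k, P phi k -> P psi k -> exists g, phi = psi * inner g) ->
  finite_set (Out G).
Proof.
move=> Pex Pinn; pose coset phi := [set phi * i | i in Inn G]%classic.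
have cosetS phi psi k : P phi k -> P psi k -> (coset phi `<=` coset psi)%classic.
  move=> pk qk; have [g ->] := Pinn _ _ _ pk qk.
  move=> _ [_ [h _ <-] <-]; exists (inner (g * h)); first by exists (g * h).
  by apply: autP => x /=; rewrite /inner_fun invgM !mulgA.
have [rep repP] := witness_fun 1 P.
apply: (@sub_finite_set _ _ [set coset (rep k) | k in [set: F]]%classic); last first.
  exact/finite_image/finite_finset.
move=> _ [phi _ <-]; have [k pk] := Pex phi; exists k => //.
by apply/seteqP; split; apply: cosetS; eauto.
Qed.

(** * Ends and almost invariant sets *)

Lemma infinite_inj (T : Type) (E : set T) (h : nat -> T) :
  injective h -> (forall k, E (h k)) -> infinite_set E.
Proof.
move=> h_inj hE finE; apply: infinite_nat.
have := @finite_preimage _ _ E h (in2W h_inj) finE.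
by apply: sub_finite_set => k _; exact: hE.
Qed.

Lemma card_leI1_eq (T : Type) (A : set T) x y : (A #<= `I_1)%card ->
  A x -> A y -> x = y.
Proof.
move=> /pcard_leP[f] Ax Ay; apply: (@inj _ _ _ f); rewrite ?inE //.
have := @funS _ _ _ _ f _ Ax; have := @funS _ _ _ _ f _ Ay.
by rewrite /= !ltnS !leqn0 => /eqP-> /eqP->.
Qed.

Section Ends.
Variables (G : groupType) (S : seq G).
Hypothesis genS : generates S.

Lemma cayley_connected x y : exists2 p, path (cayley_adj S) x p & last x p = y.
Proof.
have [w [wS wE]] := genS (x^-1 * y); rewrite -(mulVKg x y) -{}wE.
elim: w x wS => [|[s b] w IH] x /=; first by exists [::]; rewrite //= /weval big_nil mulg1.
move=> /andP[sS /IH wP]; rewrite /weval big_cons -/(weval id w) /= mulgA.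
have [p px pl] := wP (x * (if b then s^-1 else s)).
exists (x * (if b then s^-1 else s) :: p) => //=; rewrite px andbT /cayley_adj.
by apply/orP; case: b {px pl}; [right; rewrite invgM invgK mulgVK|left; rewrite mulKg].
Qed.

Lemma component_off_boundary (F : set G) f y : F f -> ~ F y ->
  exists z t, [/\ F t, cayley_adj S t z, ~ F z & component_off S F z y].
Proof.
move=> Ff; have [p fp <-] := cayley_connected f y.
suff H x q : path (cayley_adj S) x q -> ~ F (last x q) ->
    (forall u, u \in x :: q -> ~ F u) \/
    exists z t, [/\ F t, cayley_adj S t z, ~ F z & component_off S F z (last x q)].
  by move=> /(H _ _ fp)[/(_ f (mem_head _ _))|].
elim: q x => [x _ nx|z q IH x /= /andP[xz zq] nl]; first by left => u; rewrite inE => /eqP->.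
have [offF|] := IH z zq nl; last by right.
have [Fx|nFx] := pselect (F x); last by left => u; rewrite inE => /orP[/eqP->|/offF].
by right; exists z, x; split=> //; [apply: offF; exact: mem_head|exists q].
Qed.

(** The edges across which [E] changes have finitely many endpoints. Off these, [E] is constant on
    components, so [E] and its complement would each contain an infinite component. *)
Lemma almost_invariant_ends (E : G -> bool) : number_of_ends S 1 ->
    (forall h, finite_set [set g | E g != E (g * h)]%classic) ->
    infinite_set [set g | E g]%classic -> infinite_set [set g | ~~ E g]%classic ->
  False.
Proof.
move=> [ends1 _] Efin Einf nEinf.
pose D s := [set g | E g != E (g * s)]%classic.
(* [D s] and its translate contain both ends of the edges where [E] changes; the point [1] makes [F]
   nonempty, so that every component off [F] touches [F]. *)
pose F := ([set 1] `|`
  \bigcup_(s in [set` S]) (D s `|` (fun g => g * s) @` D s))%classic.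
have finF : finite_set F.
  rewrite finite_setU; split; first exact: finite_set1.
  apply: bigcup_finite; first exact: finite_seq.
  by move=> s _; rewrite finite_setU; split; [|apply: finite_image]; exact: Efin.
have adjE x y : cayley_adj S x y -> ~ F x -> E x = E y.
  move=> xy nFx; apply/eqP/negPn/negP => Exy; apply: nFx; right.
  case/orP: xy => sS; first by exists (x^-1 * y) => //; left; rewrite /D /= mulVKg.
  by exists (y^-1 * x) => //; right; exists y; rewrite /D /= mulVKg // eq_sym.
have compE z y : component_off S F z y -> E y = E z.
  move=> [p [+ <- +]]; elim: p z => //= u p IH z /andP[zu up] offF.
  rewrite IH // => [|v vp]; last by apply: offF; rewrite inE vp orbT.
  by apply/esym/adjE => //; apply: offF; exact: mem_head.
(* Each component off [F] contains one of the finitely many neighbours of [F]; if those with value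
   [b] were all finite, so would be the level set. *)
have comp_inf b : infinite_set [set g | E g == b]%classic ->
    exists2 C, infinite_components_off S F C & exists2 z, C z & E z = b.
  move=> binf; apply: contrapT => nC; apply: binf.
  pose nbrs := (\bigcup_(s in [set` S])
    ((fun g => g * s) @` F `|` (fun g => g * s^-1) @` F))%classic.
  pose P := (nbrs `&` [set z | E z == b /\ ~ F z])%classic.
  apply: (@sub_finite_set _ _ (F `|` \bigcup_(z in P) component_off S F z)%classic).
    move=> y /= yb; have [Fy|nFy] := pselect (F y); [by left|right].
    have [|z [t [Ft tz nFz zy]]] := component_off_boundary _ nFy (f := 1); first by left.
    exists z => //; split; last by rewrite /= -(compE _ _ zy).
    case/orP: tz => sS; first by exists (t^-1 * z) => //; left; exists t; rewrite ?mulVKg.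
    by exists (z^-1 * t) => //; right; exists t => //; rewrite invgM invgK mulVKg.
  rewrite finite_setU; split=> //; apply: bigcup_finite.
    apply: finite_setIl; apply: bigcup_finite; first exact: finite_seq.
    by move=> s _; rewrite finite_setU; split; exact: finite_image.
  move=> z [_ [/= /eqP Ez nFz]]; apply: contrapT => zinf; apply: nC.
  exists (component_off S F z); first by split=> //; exists z.
  exists z => //; exists [::]; split=> // u; rewrite inE => /eqP->; exact: nFz.
have [|C1 iC1 [z1 C1z1 Ez1]] := comp_inf true.
  by apply: sub_infinite_set Einf => g /= ->.
have [|C2 iC2 [z2 C2z2 Ez2]] := comp_inf false.
  by apply: sub_infinite_set nEinf => g /= /negbTE->.
have C12 := card_leI1_eq (ends1 F finF) iC1 iC2.
case: iC1 => _ [x _ CE]; move: C1z1 C2z2; rewrite -C12 CE => /compE + /compE.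
by rewrite Ez1 Ez2 => <-.
Qed.

End Ends.

(** * Hyperbolic groups contain no undistorted flat *)

Section WordLength.
Variables (G : groupType) (S : seq G).
Hypothesis genS : generates S.

Local Notation len := (word_length S).

Lemma word_length_min g w : word_for S g w -> len g <= size w.
Proof.
rewrite /word_length => gw; case: pselect => // h; case: ex_minnP => n _; apply.
by apply/asboolP; exists w.
Qed.

Lemma word_length_ex g : exists2 w, word_for S g w & size w = len g.
Proof.
rewrite /word_length; case: pselect => [h|[]].
  by case: ex_minnP => n /asboolP[w [gw <-]] _; exists w.
by have [w gw] := genS g; exists (size w); apply/asboolP; exists w.
Qed.

Lemma word_lengthM g h : len (g * h) <= len g + len h.
Proof.
have [u [uS ug] <-] := word_length_ex g; have [v [vS vh] <-] := word_length_ex h.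
rewrite -size_cat; apply: word_length_min; split; first by rewrite all_cat uS.
by rewrite weval_cat ug vh.
Qed.

Lemma word_lengthX g n : len (g ^+ n) <= len g * n.
Proof.
elim: n => [|n IH]; last by rewrite expgS mulnS (leq_trans (word_lengthM _ _)) // leq_add2l.
by rewrite muln0; apply: (@word_length_min _ [::]); split=> //; rewrite /weval big_nil.
Qed.

Lemma four_points delta : gromov_hyperbolic S delta -> exists d : nat, forall o a b c,
  word_dist S c o + word_dist S a b <=
    maxn (word_dist S a o + word_dist S c b) (word_dist S b o + word_dist S a c) + d.
Proof.
have [d dP] : exists d : nat, (2%:R * delta <= d%:R)%R.
  by eexists; apply/ltW/(le_lt_trans (ler_norm _))/archi_boundP/normr_ge0.
move=> hyp; exists d => o a b c.
have := hyp a c b o; rewrite /gromov_product.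
move: (word_dist S a o) (word_dist S c o) (word_dist S a c) (word_dist S b o)
  (word_dist S c b) (word_dist S a b) => ao co ac bo cb ab.
rewrite lerBlDr ge_min => /orP[le_xz|le_yz]; rewrite addn_maxl leq_max; apply/orP; [right|left];
  by rewrite -(ler_nat rat) !natrD; lra.
Qed.

Section NoFlat.
Local Open Scope nat_scope.
Variables (a b : G) (c d : nat).
Hypotheses (ab : commute a b) (c0 : 0 < c).
Let pt p q : G := (a ^+ p * b ^+ q)%g.
Hypothesis pt_l : forall p q p' q', p <= p' -> p' - p <= c * word_dist S (pt p q) (pt p' q').
Hypothesis pt_r : forall p q p' q', q <= q' -> q' - q <= c * word_dist S (pt p q) (pt p' q').
Hypothesis four_points : forall o x y z,
  word_dist S z o + word_dist S x y <=
    maxn (word_dist S x o + word_dist S z y) (word_dist S y o + word_dist S x z) + d.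

Let ptD p q p' q' r : ((pt p (q + r))^-1 * pt p' (q' + r) = (pt p q)^-1 * pt p' q')%g.
Proof.
have ptE u v : pt u (v + r) = (b ^+ r * pt u v)%g.
  rewrite /pt addnC expgnDr !mulgA; congr (_ * _)%g.
  exact: (commuteX2 u r ab).
by rewrite !ptE invgM -mulgA mulKg.
Qed.

(** [f] measures the distance from points of a vertical line to a fixed point at horizontal distance
    [M]. Hyperbolicity makes [f] concave up to [d], so [f 0] is at most [2 * f K + K ^ 2 * d], too
    little for the height [K * L]. *)
Lemma no_flat : False.
Proof.
(* [M] ensures [D * L <= f j]; [K] makes [K * L] equal to [c * (2 * (D * M)) + L], and [L] exceeds
   the accumulated error [c * K ^ 2 * d]. *)
pose D := (maxn (len a) (maxn (len b) (len b^-1%g))).+1.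
pose K := (2 * c ^ 2 * D ^ 2).+1.
pose L := (c * K ^ 2 * d).+1.
pose M := c * D * L.
pose f j := word_dist S (pt 0 (j * L)) (pt M (K * L)).
have fM j : D * L <= f j.
  rewrite -(leq_pmul2l c0) mulnA -/M.
  by have := pt_l (j * L) (K * L) (leq0n M); rewrite subn0.
(* Four points on two vertical lines: the diagonals are [f j.+2] and, after translation by [b ^+ L],
   [f j]. The vertical sides are at most [D * L], hence dominated by [f j.+1]. *)
have step j : f j.+2 + f j <= f j.+1 + f j.+1 + d.
  have fS i : word_dist S (pt 0 (i.+1 * L)) (pt M (K.+1 * L)) = f i.
    by rewrite /f /word_dist !mulSn ![L + _]addnC ptD.
  have := four_points (pt M (K * L)) (pt 0 (j.+1 * L)) (pt M (K.+1 * L)) (pt 0 (j.+2 * L)).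
  rewrite !fS -/(f _) -/(f _).
  move/leq_trans; apply; rewrite leq_add2r geq_max leqnn /=.
  apply: leq_add; apply: leq_trans (fM j.+1).
    rewrite /word_dist -[pt M (K * L)]mulg1 mulSn addnC.
    suff -> : ((pt M (K * L + L))^-1 * (pt M (K * L) * 1) = b^-1 ^+ L)%g.
      apply: leq_trans (word_lengthX _ _) _; rewrite leq_mul2r; apply/orP; right.
      by rewrite /D leqW // !leq_max leqnn !orbT.
    by rewrite mulg1 /pt expgnDr (mulgA (a ^+ M)%g) invgM mulgVK expVgn.
  rewrite /word_dist [j.+2 * L]mulSn [L + _]addnC /pt expgnDr (mulgA (a ^+ 0)%g) mulKg.
  apply: leq_trans (word_lengthX _ _) _; rewrite leq_mul2r; apply/orP; right.
  by rewrite /D leqW // !leq_max leqnn !orbT.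
have sym n : n < K -> f (K + n.+1) + f (K - n.+1) <= f (K + n) + f (K - n) + n.*2.+1 * d.
  elim: n => [|n IH] nK.
    have := step K.-1; rewrite subn1 addn1 addn0 subn0 prednK // mul1n; lia.
  have {}IH := IH (ltnW nK).
  have s1 := step (K + n); have s2 := step (K - n.+2).
  have e1 : (K - n.+2).+1 = K - n.+1 by lia.
  have e2 : (K - n.+2).+2 = K - n by lia.
  rewrite e2 e1 in s2; rewrite -!addnS in s1.
  have -> : n.+1.*2.+1 * d = n.*2.+1 * d + 2 * d by rewrite -mulnDl; congr (_ * _); lia.
  lia.
have sum n : n <= K -> f (K + n) + f (K - n) <= 2 * f K + n ^ 2 * d.
  elim: n => [|n IH] nK; first by rewrite addn0 subn0; lia.
  apply: leq_trans (sym n nK) _; have {}IH := IH (ltnW nK).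
  have -> : n.+1 ^ 2 * d = n ^ 2 * d + n.*2.+1 * d by rewrite -mulnDl; congr (_ * _); lia.
  lia.
have fK : f K <= D * M.
  rewrite /f -[K * L in X in word_dist _ X _]add0n -[K * L in X in word_dist _ _ X]add0n.
  rewrite /word_dist ptD /pt !expg0 !mulg1 invg1 mul1g.
  apply: leq_trans (word_lengthX _ _) _; rewrite leq_mul2r; apply/orP; right.
  by rewrite /D leqW // leq_maxl.
have f0 : K * L <= c * f 0 by have := pt_r 0 M (leq0n (K * L)); rewrite subn0.
suff : c * f 0 < K * L by rewrite ltnNge f0.
have le0 : f 0 <= 2 * (D * M) + K ^ 2 * d.
  have := sum K (leqnn K); rewrite subnn; move: (f (K + K)) => u; lia.
have KLE : K * L = c * (2 * (D * M)) + L.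
  by rewrite {1}/K mulSn addnC /M; congr addn; ring.
rewrite KLE; apply: leq_ltn_trans (leq_mul (leqnn c) le0) _.
by rewrite mulnDr ltn_add2l /L mulnA.
Qed.

End NoFlat.

Lemma hyperbolic_no_flat delta (a b : G) c : gromov_hyperbolic S delta ->
    commute a b -> 0 < c ->
    (forall p q p' q', p <= p' -> p' - p <=
      c * word_dist S (a ^+ p * b ^+ q) (a ^+ p' * b ^+ q')) ->
    (forall p q p' q', q <= q' -> q' - q <=
      c * word_dist S (a ^+ p * b ^+ q) (a ^+ p' * b ^+ q')) ->
  False.
Proof.
by move=> /four_points[d dP] ab c0 ? ?; apply: no_flat ab c0 _ _ dP.
Qed.

End WordLength.

(** * Generators and universal property of the graph product *)

Section GraphProduct.
Variables (N : nat) (e : rel 'I_N) (m : 'I_N -> nat).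
Hypotheses (e_sym : symmetric e) (m_gt1 : forall i, 1 < m i).
Local Notation W := (graph_product e m).
Local Notation R := (graph_product_rel e m).

Definition gen (i : 'I_N) : W := pclass R [:: (i, false)].

Lemma weval_gen w : weval gen w = pclass R w.
Proof.
elim: w => [|[x b] w IH]; first by rewrite /weval big_nil.
by rewrite pclass_cons -IH /weval big_cons.
Qed.

Lemma weval_nseq (H : groupType) (f : 'I_N -> H) i n :
  weval f (nseq n (i, false)) = f i ^+ n.
Proof.
elim: n => [|n IH]; first by rewrite /weval big_nil expg0.
by rewrite /= -cat1s weval_cat IH expgS /weval big_seq1.
Qed.

Lemma gen_order i : gen i ^+ m i = 1.
Proof.
rewrite -weval_nseq weval_gen -[1](pclass_nil R); apply/pclassP.
by have := pres_eq_rel [::] [::] (gp_order e m i); rewrite /= !cats0.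
Qed.

Lemma gen_comm i j : e i j -> gen i * gen j = gen j * gen i.
Proof.
move=> eij; rewrite -!pclassM; apply/pclassP.
exact: (pres_eq_rel [::] [::] (gp_comm m eij)).
Qed.

Lemma gp_hom_ex (H : groupType) (f : 'I_N -> H) :
    (forall i, f i ^+ m i = 1) ->
    (forall i j, e i j -> f i * f j = f j * f i) ->
  exists2 F : W -> H, {morph F : x y / x * y} & forall i, F (gen i) = f i.
Proof.
move=> fm fe; apply: pres_hom_ex => l r [i|j k ejk].
  by rewrite weval_nseq fm /weval big_nil.
by rewrite /weval !big_cons big_nil /= !mulg1 fe.
Qed.

Implicit Types A B K : {set 'I_N}.

(** * Words in syllables [gen i ^+ a] *)

Local Notation syl := (seq ('I_N * nat)).

Definition ev (w : syl) : W := \prod_(l <- w) gen l.1 ^+ l.2.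

Lemma ev_nil : ev [::] = 1. Proof. by rewrite /ev big_nil. Qed.

Lemma ev_cons x a w : ev ((x, a) :: w) = gen x ^+ a * ev w.
Proof. by rewrite /ev big_cons. Qed.

Lemma ev1 x a : ev [:: (x, a)] = gen x ^+ a.
Proof. by rewrite /ev big_seq1. Qed.

Lemma ev_cat u v : ev (u ++ v) = ev u * ev v.
Proof. by rewrite /ev big_cat. Qed.

Lemma gen_expM i k : gen i ^+ (m i * k) = 1.
Proof. by rewrite expgnA gen_order expg1n. Qed.

Lemma gen_mod i a : gen i ^+ (a %% m i) = gen i ^+ a.
Proof.
by rewrite [in RHS](divn_eq a (m i)) expgnDr mulnC gen_expM mul1g.
Qed.

Lemma gen_eqmod i a b : a = b %[mod m i] -> gen i ^+ a = gen i ^+ b.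
Proof. by move=> ab; rewrite -gen_mod ab gen_mod. Qed.

Lemma m_gt0 i : 0 < m i. Proof. exact: ltnW. Qed.

Lemma genV i : (gen i)^-1 = gen i ^+ (m i).-1.
Proof.
by apply: (mulgI (gen i)); rewrite mulgV -expgS prednK ?gen_order ?m_gt0.
Qed.

(** * Special subgroups and retractions onto them *)

Definition sub A (g : W) : Prop :=
  exists2 w : syl, all (fun l => l.1 \in A) w & g = ev w.

Lemma sub1 A : sub A 1.
Proof. by exists [::]; rewrite ?ev_nil. Qed.

Lemma subM A g h : sub A g -> sub A h -> sub A (g * h).
Proof. by move=> [u uA ->] [v vA ->]; exists (u ++ v); rewrite ?all_cat ?uA ?ev_cat. Qed.

Lemma sub_genX A i a : i \in A -> sub A (gen i ^+ a).
Proof. by move=> iA; exists [:: (i, a)]; rewrite ?ev1 //= iA. Qed.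

Lemma sub_gen A i : i \in A -> sub A (gen i).
Proof. by move=> /(sub_genX 1); rewrite expg1. Qed.

Lemma sub_ind A (P : W -> Prop) : P 1 ->
    (forall g i a, sub A g -> i \in A -> P g -> P (g * gen i ^+ a)) ->
  forall g, sub A g -> P g.
Proof.
move=> P1 PM g [w wA ->]; elim/last_ind: w wA => [|w [i a] IH]; first by rewrite ev_nil.
rewrite all_rcons /= => /andP[iA wA]; rewrite -cats1 ev_cat ev1.
by apply: PM => //; [exists w|exact: IH].
Qed.

Lemma subV A g : sub A g -> sub A g^-1.
Proof.
move=> sg; elim/sub_ind: g / sg => [|g i a _ iA IH]; first by rewrite invg1; exact: sub1.
rewrite invgM; apply: subM IH; rewrite -expVgn genV -expgnA.
exact: sub_genX.
Qed.

Lemma subS A B g : A \subset B -> sub A g -> sub B g.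
Proof.
move=> /fintype.subsetP AB [w wA ->]; exists w => //.
by apply: sub_all wA => l; exact: AB.
Qed.

Lemma subMr A g h : sub A h -> sub A (g * h) <-> sub A g.
Proof.
move=> sh; split=> [gh|sg]; last exact: subM.
by rewrite -(mulgK h g); apply: subM gh (subV sh).
Qed.

Lemma subMl A g h : sub A g -> sub A (g * h) <-> sub A h.
Proof.
move=> sg; split=> [gh|sh]; last exact: subM.
by rewrite -(mulKg g h); apply: subM (subV sg) gh.
Qed.

Lemma sub_T g : sub [set: _]%SET g.
Proof.
rewrite -(pclass_repr g); elim: (repr g) => [|[x b] w IH]; first exact: sub1.
rewrite pclass_cons; apply: subM IH; case: b; last exact: (@sub_gen _ x).
by apply: subV; exact: (@sub_gen _ x).
Qed.

Lemma gp_ind (P : W -> Prop) : P 1 ->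
    (forall g i a, P g -> P (g * gen i ^+ a)) -> forall g, P g.
Proof.
move=> P1 PM g; have := sub_T g; apply: sub_ind => // h i a _ _; exact: PM.
Qed.

Lemma gp_hom_eq (H : groupType) (f1 f2 : W -> H) :
    {morph f1 : x y / x * y} -> {morph f2 : x y / x * y} ->
  (forall i, f1 (gen i) = f2 (gen i)) -> f1 =1 f2.
Proof.
move=> f1M f2M f12; apply: gp_ind => [|g i a IH]; first by rewrite !morph1g.
by rewrite f1M f2M IH (morphXg _ f1M) (morphXg _ f2M) f12.
Qed.

Lemma sub_comm A h : (forall i, i \in A -> commute h (gen i)) ->
  forall g, sub A g -> commute h g.
Proof.
move=> hA; apply: sub_ind => [|g i a _ iA IH]; first exact: commute1.
by apply: commuteM => //; apply: commuteX; exact: hA.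
Qed.

(** Sending the generators outside [A] to [1] respects the relations. *)
Lemma retract_ex A : exists f : W -> W,
  [/\ {morph f : x y / x * y}, forall g, sub A g -> f g = g &
      forall B g, sub B g -> sub (A :&: B) (f g)].
Proof.
have [i|i j eij|f fM fE] := @gp_hom_ex W (fun i => if i \in A then gen i else 1).
- by case: ifP => _; rewrite ?gen_order ?expg1n.
- by do 2!case: ifP => _; rewrite ?mulg1 ?mul1g //; exact: gen_comm.
exists f; split=> // [|B]; apply: sub_ind => [|g i a _ iB IH]; rewrite ?morph1g //.
- by rewrite fM IH morphXg // fE iB.
- exact: sub1.
rewrite fM morphXg // fE; apply: subM IH _; case: ifP => [iA|_].
  by apply: sub_genX; rewrite inE iA iB.
by rewrite expg1n; exact: sub1.
Qed.

Lemma subI A B g : sub A g -> sub B g -> sub (A :&: B) g.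
Proof. by have [f [_ fA fB]] := retract_ex A => /fA {2}<- /fB. Qed.

Definition star (x : 'I_N) : {set 'I_N} := [set y | (y == x) || e x y].

Lemma star_refl x : x \in star x. Proof. by rewrite inE eqxx. Qed.

Lemma star_comm x g : sub (star x) g -> commute (gen x) g.
Proof.
apply: sub_comm => y; rewrite inE => /orP[/eqP->|]; first exact: commute_refl.
exact: gen_comm.
Qed.

(** * Crossing numbers of hyperplanes *)

Section Cocycle.
Variables (A : zmodType) (c : W -> 'I_N -> A).
Hypothesis c_order : forall g i, (\sum_(k < m i) c (g * gen i ^+ k)%g i = 0)%R.
Hypothesis c_comm : forall g i j, e i j ->
  (c g i + c (g * gen i)%g j = c g j + c (g * gen j)%g i)%R.

Let step g (l : 'I_N * bool) : W := if l.2 then g / gen l.1 else g * gen l.1.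
Let cstep g (l : 'I_N * bool) : A :=
  if l.2 then (- c (g / gen l.1) l.1)%R else c g l.1.
Let Fixpoint cword g (w : word 'I_N) : A :=
  if w is l :: w' then (cstep g l + cword (step g l) w')%R else 0%R.

Let cword_cat g u v : cword g (u ++ v) = (cword g u + cword (g * pclass R u)%g v)%R.
Proof.
elim: u g => [|[x b] u IH] g; first by rewrite add0r pclass_nil mulg1.
rewrite /= IH addrA pclass_cons mulgA; congr (_ + cword (_ * _)%g _)%R.
by rewrite /step /=; case: b.
Qed.

Let cword_pres_eq u v : pres_eq R u v -> forall g, cword g u = cword g v.
Proof.
elim=> {u v} [//|u v _ IH g|u v w _ IH1 _ IH2 g|u v x b|u v l r lr] //.
- by rewrite IH1.
- have cancel g : (cstep g (x, b) + (cstep (step g (x, b)) (x, ~~ b) +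
      cword (step (step g (x, b)) (x, ~~ b)) v) = cword g v)%R.
    rewrite addrA; case: b; rewrite /cstep /step /= ?mulgVK ?mulgK ?addrN ?addNr;
      exact: add0r.
  by move=> g; rewrite (cword_cat g u) (cword_cat g u v); congr (_ + _)%R; exact: cancel.
- move=> g; have lrE : pclass R l = pclass R r.
    by apply/pclassP; have := pres_eq_rel [::] [::] lr; rewrite /= !cats0.
  rewrite !cword_cat -lrE; congr (_ + (_ + _))%R; set h := (g * _)%g.
  case: lr {lrE} h => [i|j k ejk] h /=; last by rewrite /cstep /step /= !addr0 c_comm.
  rewrite -[RHS](c_order h i); elim: (m i) h => [|n IH] h; first by rewrite big_ord0.
  rewrite big_ord_recl expg0 mulg1 /= IH; congr (_ + _)%R.
  by apply: eq_bigr => k _; rewrite /step /= -mulgA -expgS.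
Qed.

(** [c g i] is a weight on the edge from [g] to [g * gen i]. Its sum around every relator loop
    vanishes, so the sum along a path depends only on its endpoints. *)
Lemma cocycle_ex : exists F : W -> W -> A,
  (forall g h h', F g (h * h')%g = (F g h + F (g * h)%g h')%R) /\
  (forall g i, F g (gen i) = c g i).
Proof.
have FE g w : cword g (repr (pclass R w)) = cword g w.
  by apply: cword_pres_eq; exact: pres_repr.
exists (fun g h => cword g (repr h)); split=> [g h h'|g i]; last first.
  by rewrite FE /= /cstep /= addr0.
rewrite -[h in LHS]pclass_repr -[h' in LHS]pclass_repr -pclassM FE cword_cat.
by rewrite pclass_repr.
Qed.

End Cocycle.

(* The sector function of the hyperplane dual to the edge from [1] to [gen x]:
   walking along a path from [1], it changes exactly when the path crosses
   this hyperplane, that is, follows an edge labelled [x] starting in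
   [sub (star x)]. *)
Lemma sector_ex x : exists s : W -> 'Z_(m x), s 1 = 0%R /\
  forall g y a,
    s (g * gen y ^+ a)%g = (s g + (if (y == x) && `[< sub (star x) g >] then a%:R else 0))%R.
Proof.
pose c g y : 'Z_(m x) := if (y == x) && `[< sub (star x) g >] then 1%R else 0%R.
have cX g y k : c (g * gen y ^+ k) y = c g y.
  rewrite /c; case: eqP => //= ->; congr (if _ then _ else _).
  by apply: asbool_equiv_eq; apply: subMr; apply: sub_genX; exact: star_refl.
have [||F [FM FE]] := @cocycle_ex _ c.
- move=> g i; under eq_bigr do rewrite cX.
  rewrite sumr_const card_ord /c; case: eqP => [->|_] /=; last by rewrite mul0rn.
  by case: asboolP => _; rewrite ?mul0rn // pchar_Zp.
- have cN g i j : e i j -> c (g * gen j) i = c g i.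
    move=> eij; rewrite /c; case: eqP => //= <-; congr (if _ then _ else _).
    by apply: asbool_equiv_eq; apply: subMr; apply: sub_gen; rewrite inE eij orbT.
  by move=> g i j eij; rewrite !cN // 1?e_sym // addrC.
have F1 g : F g 1 = 0%R.
  by apply: (addrI (F g 1)); rewrite -{2}[g in F g 1]mulg1 -FM mulg1 addr0.
have FX g y a : F g (gen y ^+ a) = (c g y *+ a)%R.
  elim: a => [|a IH]; first by rewrite expg0 F1.
  by rewrite expgSr FM IH FE cX mulrSr.
exists (F 1); split=> // g y a; rewrite FM mul1g FX; congr (_ + _)%R.
by rewrite /c; case: ifP => _; rewrite ?mul0rn.
Qed.

Definition sector x : W -> 'Z_(m x) := projT1 (cid (sector_ex x)).

Lemma sector1 x : sector x 1 = 0%R.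
Proof. by rewrite /sector; case: cid => s []. Qed.

Lemma sectorM x g y a : sector x (g * gen y ^+ a) =
  (sector x g + (if (y == x) && `[< sub (star x) g >] then a%:R else 0))%R.
Proof. by rewrite /sector; case: cid => s []. Qed.

Lemma sector_genX x a : sector x (gen x ^+ a) = a%:R%R.
Proof.
rewrite -[X in sector x X]mul1g sectorM sector1 add0r eqxx.
by case: asboolP => //= -[]; exact: sub1.
Qed.

Lemma natZ_eq0 x a : (a%:R == 0 :> 'Z_(m x))%R = (m x %| a).
Proof. by rewrite -val_eqE /= val_Zp_nat. Qed.

Lemma sector_starl x k g : sub (star x) k ->
  sector x (k * g) = (sector x k + sector x g)%R.
Proof.
move=> sk; elim/gp_ind: g => [|g y a IH]; first by rewrite mulg1 sector1 addr0.
by rewrite mulgA !sectorM IH addrA (asbool_equiv_eq (subMl g sk)).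
Qed.

(* A special coset [g * sub A] stays on one side of a hyperplane unless it
   contains an edge crossing it. *)
Lemma sector_coset x A g w : sub A w ->
  sector x (g * w) = sector x g \/
  x \in A /\ exists2 w', sub A w' & sub (star x) (g * w').
Proof.
move: w; apply: sub_ind => [|w y a sw yA IH]; first by left; rewrite mulg1.
case: IH => [IH|]; last by right.
rewrite mulgA sectorM IH; case: eqP => [<-|_]; last by left; rewrite addr0.
by case: asboolP => /= gw; [right; split=> //; exists w|left; rewrite addr0].
Qed.

Lemma sector_subC1 x g w : sub (~: [set x]) w -> sector x (g * w) = sector x g.
Proof.
by move=> /(@sector_coset x _ g)[//|[]]; rewrite !inE eqxx.
Qed.

(** If [gen x] commutes with some [k] outside [sub (star x)], left multiplication by [gen x] shifts
    the sector of [k] by one, whereas the edge labelled [x] at [k] does not cross the hyperplane. *)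
Lemma sub_star_conj x g h : (g * gen x * g^-1 = h * gen x * h^-1) <-> sub (star x) (g^-1 * h).
Proof.
split=> [gh|/star_comm gh]; last first.
  apply: (mulIg h); rewrite mulgVK; apply: (mulgI g^-1).
  by rewrite !mulgA mulVg mul1g -[g^-1 * h * _]gh !mulgA.
have : commute (gen x) (g^-1 * h).
  rewrite /commute; suff -> : gen x * (g^-1 * h) = g^-1 * (g * gen x * g^-1) * h.
    by rewrite gh !mulgA mulgVK.
  by rewrite !mulgA mulVg mul1g.
move: (_ * _) => k kC; apply: contrapT => nk.
have /eqP : sector x (gen x * k) = sector x (k * gen x ^+ 1) by rewrite kC expg1.
rewrite sector_starl; last by apply: sub_gen; exact: star_refl.
rewrite sectorM eqxx /= (asboolF nk) addr0 -[gen x]expg1 sector_genX.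
by rewrite -subr_eq0 addrK oner_eq0.
Qed.

Lemma centralizer_gen x g : commute (gen x) g -> sub (star x) g.
Proof.
move=> xg; have := sub_star_conj x 1 g; rewrite invg1 mulg1 !mul1g => -[+ _]; apply.
by rewrite -xg mulgK.
Qed.

(** * The alternating normal form with respect to one generator *)

Definition alt x (L : seq (nat * W)) : W := \prod_(l <- L) (gen x ^+ l.1 * l.2).

Lemma alt_nil x : alt x [::] = 1. Proof. by rewrite /alt big_nil. Qed.

Lemma alt_cons x l L : alt x (l :: L) = gen x ^+ l.1 * l.2 * alt x L.
Proof. by rewrite /alt big_cons. Qed.

Lemma alt1 x l : alt x [:: l] = gen x ^+ l.1 * l.2.
Proof. by rewrite /alt big_seq1. Qed.

Lemma alt_cat x L1 L2 : alt x (L1 ++ L2) = alt x L1 * alt x L2.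
Proof. by rewrite /alt big_cat. Qed.

(** Reducedness in [W] seen as the amalgam of [sub (star x)] and [sub (~: [set x])] over the
    subgroup of the link of [x]. *)
Definition alt_reduced x (l : nat * W) : Prop :=
  [/\ ~~ (m x %| l.1), sub (~: [set x]) l.2 & ~ sub (star x) l.2].

Lemma alt_reducedP x (L : seq (nat * W)) : L != [::] -> {in L, forall l, alt_reduced x l} ->
  sector x (alt x L) = ((head (0%N, 1%g) L).1%:R)%R /\ ~ sub (star x) (alt x L).
Proof.
have [n] := ubnP (size L); elim: n L => // n IH L; rewrite ltnS => Ln L0 Lr; split.
  case/lastP: L Ln L0 Lr => [//|L l] Ln _ Lr; rewrite -cats1 alt_cat alt1 mulgA.
  have [_ ul _] : alt_reduced x l by apply: Lr; rewrite mem_rcons mem_head.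
  rewrite sector_subC1 // sectorM eqxx /=.
  have [->|L0] := eqVneq L [::].
    by rewrite alt_nil sector1 add0r; case: asboolP => // -[]; exact: sub1.
  have [||-> /asboolF ->] := IH L _ L0; first by rewrite size_rcons in Ln.
    by move=> k kL; apply: Lr; rewrite mem_rcons inE kL orbT.
  by rewrite addr0; case: L L0 {Ln Lr}.
case: L Ln L0 Lr => [//|[a u] L] Ln _ Lr; rewrite alt_cons /= => aul.
have [_ /= ux nu] : alt_reduced x (a, u) by apply: Lr; rewrite mem_head.
have {aul} ul : sub (star x) (u * alt x L).
  by apply/(subMl _ (sub_genX a (star_refl x))); rewrite mulgA.
have [L0|L0] := eqVneq L [::]; first by apply: nu; rewrite L0 alt_nil mulg1 in ul.
have Lr' : {in L, forall l, alt_reduced x l}.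
  by move=> k kL; apply: Lr; rewrite inE kL orbT.
have [sL _] := IH L Ln L0 Lr'.
(* The coset of [u^-1] is disjoint from [sub (star x)], so its sector is constantly [0]; but it
   contains [alt x L], whose sector is a nonzero exponent. *)
have [|[_ [w' sw']]] := sector_coset x u^-1 ul; last first.
  move=> /(subMr _ sw') /subV; rewrite invgK; exact: nu.
rewrite mulKg sL -[u^-1]mul1g sector_subC1 ?sector1; last exact: subV.
case: L {Ln Lr IH ul sL} L0 Lr' => // l L _ Lr /= /eqP.
by have [+ _ _] := Lr l (mem_head _ _); rewrite natZ_eq0 => /negP.
Qed.

(** * Elements of finite order *)

Definition clique K : Prop := {in K &, forall i j, i != j -> e i j}.

Definition alt_rep x A n g : Prop := exists h (L : seq (nat * W)),
  [/\ size L = n.+1, (forall l, l \in L -> sub (A :\ x) l.2) & g ^ h = alt x L].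

Lemma alt_rep_ex x A g : x \in A -> sub A g -> exists n, alt_rep x A n g.
Proof.
move=> xA; suff H : sub A g -> exists L : seq (nat * W),
    [/\ L != [::], (forall l, l \in L -> sub (A :\ x) l.2) & g = alt x L].
  move=> /H[L [L0 LA gE]]; exists (size L).-1, 1, L; split=> //.
    by rewrite prednK // lt0n size_eq0.
  by rewrite conjg1.
move: g; apply: sub_ind => [|_ y a _ yA [L [L0 LA ->]]].
  exists [:: (0, 1)]; split=> // [l|]; last by rewrite alt1 mulg1.
  by rewrite inE => /eqP->; exact: sub1.
have [->|yx] := eqVneq y x.
  exists (rcons L (a, 1)); split; first by case: (L).
    by move=> l; rewrite mem_rcons inE => /orP[/eqP->|/LA//]; exact: sub1.
  by rewrite -cats1 alt_cat alt1 mulg1.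
case/lastP: L L0 LA => [//|L [b u]] L0 LA; exists (rcons L (b, u * gen y ^+ a)); split.
- by case: (L).
- move=> l; rewrite mem_rcons inE => /orP[/eqP->|lL] /=.
    apply: subM; last by apply: sub_genX; rewrite !inE yx.
    by apply: (LA (b, u)); rewrite mem_rcons mem_head.
  by apply: LA; rewrite mem_rcons inE lL orbT.
- by rewrite -!cats1 !alt_cat !alt1 !mulgA.
Qed.

Lemma alt_rep_rot x A n g h L1 L2 : size (L1 ++ L2) = n.+1 ->
    (forall l, l \in L1 ++ L2 -> sub (A :\ x) l.2) -> g ^ h = alt x (L1 ++ L2) ->
  [/\ size (L2 ++ L1) = n.+1, (forall l, l \in L2 ++ L1 -> sub (A :\ x) l.2) &
    exists h', g ^ h' = alt x (L2 ++ L1)].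
Proof.
move=> sL LA gh; split; first by rewrite size_cat addnC -size_cat.
  by move=> l; rewrite mem_cat orbC -mem_cat; exact: LA.
exists (h * alt x L1); rewrite conjgM gh !alt_cat.
by rewrite conjgE -!mulgA mulKg.
Qed.

(** Cyclic reduction: conjugation rotates the product until the unreduced syllable merges with a
    neighbour. Either its power of [gen x] is trivial, or [l.2] commutes with [gen x] and exponents
    add. *)
Lemma alt_rep_pred x A n g h L l : x \in A -> size L = n.+2 ->
    (forall l, l \in L -> sub (A :\ x) l.2) -> g ^ h = alt x L ->
    l \in L -> ~ alt_reduced x l -> alt_rep x A n g.
Proof.
move=> xA sL LA gh lL nl.
have lA : sub (A :\ x) l.2 by exact: LA.
case/splitPr: lL sL LA gh => L1 L2 sL LA gh.
have [xl|xl] := boolP (m x %| l.1).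
  rewrite -cat1s catA in sL LA gh.
  have [sL' LA' [h' gh']] := alt_rep_rot sL LA gh.
  rewrite catA in sL' LA' gh'; move: sL' LA' gh'.
  case/lastP: (L2 ++ L1) => [|L' [b u]]; first by [].
  rewrite -!cats1 -catA /= size_cat /= addn2 => -[sL'] LA' gh'.
  exists h', (L' ++ [:: (b, u * l.2)]); split; first by rewrite size_cat addn1 sL'.
    move=> k; rewrite mem_cat inE => /orP[kL|/eqP->].
      by apply: LA'; rewrite mem_cat kL.
    by apply: subM => //; apply: (LA' (b, u)); rewrite mem_cat mem_head orbT.
  rewrite gh' !alt_cat !alt_cons alt_nil !mulg1 /=; case/dvdnP: xl => c ->.
  by rewrite mulnC gen_expM mul1g !mulgA.
have sl : sub (star x) l.2.
  apply: contrapT => nsl; apply: nl; split=> //; apply: subS lA.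
  by apply/fintype.subsetP => y; rewrite !inE => /andP[].
have [sL' LA' [h' gh']] := alt_rep_rot sL LA gh.
move: sL' LA' gh'; rewrite /=; case: (L2 ++ L1) => // -[b u] L' [sL'] LA' gh'.
exists h', ((l.1 + b, l.2 * u) :: L'); split; first by rewrite /= sL'.
  move=> k; rewrite inE => /orP[/eqP->|kL]; last by apply: LA'; rewrite !inE kL !orbT.
  by apply: subM => //; apply: (LA' (b, u)); rewrite !inE eqxx orbT.
rewrite gh' !alt_cons /= expgnDr !mulgA; congr (_ * _ * _).
by rewrite -!mulgA; congr (_ * _); apply/esym/commute_sym/commuteX/commute_sym/star_comm.
Qed.

(** For nonadjacent [x], [y] in [A], take a conjugate with fewest alternating syllables. If it is
    reduced, so are its powers, which are then nontrivial. Otherwise it has one syllable and lies in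
    [sub (A :\ x)] or in [sub (A :&: star x)], which omits [y]. *)
Lemma fin_order_conj A g k : sub A g -> 0 < k -> g ^+ k = 1 ->
  exists K h, [/\ K \subset A, clique K & sub K (g ^ h)].
Proof.
have [n] := ubnP #|A|; elim: n A g => // n IH A g; rewrite ltnS => An sg k0 gk.
have [cA|] := pselect (clique A); first by exists A, 1; split=> //; rewrite conjg1.
move=> /existsNP[x /existsNP[y /not_implyP[xA /not_implyP[yA /not_implyP[xy /negP nxy]]]]].
have IHB B h : B \proper A -> sub B (g ^ h) ->
    exists K h', [/\ K \subset A, clique K & sub K (g ^ h')].
  move=> BA sB; have [||K [h' [KB cK sK]]] := IH B (g ^ h) _ sB k0.
  - exact: leq_trans (proper_card BA) An.
  - by rewrite -conjXg gk conj1g.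
  by exists K, (h * h'); rewrite conjgM; split=> //; exact: fintype.subset_trans KB (proper_sub BA).
have [p0 rep0] := alt_rep_ex xA sg.
have ex : exists p, `[< alt_rep x A p g >] by exists p0; exact/asboolP.
case: (ex_minnP ex) => p /asboolP[h [L [sL LA gh]]] pmin.
have [red|] := pselect {in L, forall l, alt_reduced x l}.
  have [||_ []] := @alt_reducedP x (flatten (nseq k L)).
  - by case: k k0 {gk IH IHB} => // k _; case: L sL {LA gh red}.
  - by move=> l /flattenP[L' /nseqP[-> _]]; exact: red.
  suff -> : alt x (flatten (nseq k L)) = 1 by exact: sub1.
  rewrite -(conj1g h) -gk conjXg gh; elim: (k) => [|j IHj]; first by rewrite alt_nil expg0.
  by rewrite /= alt_cat IHj expgS.
move=> /existsNP[l /not_implyP[lL nl]].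
case: p sL pmin => [|p] sL pmin; last first.
  have /asboolP/pmin := alt_rep_pred xA sL LA gh lL nl.
  by rewrite ltnn.
case: L sL LA gh lL => // l' [|//] _ LA gh lL.
move: lL LA gh; rewrite inE => /eqP <-; rewrite alt1 => LA gh.
have lA : sub (A :\ x) l.2 by apply: LA; rewrite mem_head.
have [/dvdnP[c lc]|xl] := boolP (m x %| l.1).
  apply: (IHB (A :\ x) h); first exact: properD1.
  by rewrite gh lc mulnC gen_expM mul1g.
have sl : sub (star x) l.2.
  apply: contrapT => nsl; apply: nl; split=> //; apply: subS lA.
  by apply/fintype.subsetP => z; rewrite !inE => /andP[].
apply: (IHB (A :&: star x) h).
  apply/properP; split; first exact: subsetIl.
  by exists y => //; rewrite !inE yA eq_sym (negbTE xy) (negbTE nxy).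
rewrite gh; apply: subM; first by apply: sub_genX; rewrite inE xA star_refl.
by apply: subI sl; apply: subS lA; exact: subD1set.
Qed.

(** * Hyperplanes crossed by a path *)

(* The hyperplane [(x, h * sub (star x))] is encoded by [x] and by the rotation
   [h * gen x * h^-1] around it, cf. [sub_star_conj]; [rots p w] lists the
   hyperplanes crossed by the path that starts at [p] and reads [w]. *)
Fixpoint rots (p : W) (w : syl) : seq ('I_N * W) :=
  if w is l :: w' then (l.1, p * gen l.1 * p^-1) :: rots (p * gen l.1 ^+ l.2) w'
  else [::].

Lemma size_rots p w : size (rots p w) = size w.
Proof. by elim: w p => //= l w IH p; rewrite IH. Qed.

Lemma mem_rots p w (k : 'I_N * W) : k \in rots p w -> exists u b v,
  w = u ++ (k.1, b) :: v /\ k.2 = p * ev u * gen k.1 * (p * ev u)^-1.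
Proof.
elim: w p => //= -[x a] w IH p; rewrite inE => /orP[/eqP-> /=|/IH[u [b [v [-> ->]]]]].
  by exists [::], a, w; rewrite ev_nil mulg1.
by exists ((x, a) :: u), b, v; rewrite ev_cons /= !mulgA.
Qed.

(** Between two crossings of the same hyperplane the path reads an element commuting with [gen x],
    so the two syllables merge. *)
Lemma rots_merge p w : ~~ uniq (rots p w) -> exists w',
  [/\ size w' < size w, ev w' = ev w &
      forall A, all (fun l => l.1 \in A) w -> all (fun l => l.1 \in A) w'].
Proof.
elim: w p => //= -[x a] w IH p; rewrite negb_and negbK => /orP[|/IH[w' [sw ew aw]]].
  move=> /mem_rots /= [u [b [v [-> /sub_star_conj]]]]; rewrite -!mulgA mulKg => /star_comm xu.
  exists ((x, b + a) :: u ++ v); split.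
  - by rewrite /= !size_cat /= addnS.
  - rewrite !ev_cons !ev_cat ev_cons expgnDr !mulgA; congr (_ * _).
    by rewrite (commuteX b (commute_sym xu)) mulgA.
  - by move=> A; rewrite /= !all_cat /= => /and4P[-> -> _ ->].
exists ((x, a) :: w'); split=> //=; first by rewrite !ev_cons ew.
by move=> A /andP[-> /aw].
Qed.

(** A shortest word crosses no hyperplane twice, and inside a clique every rotation crossed is one
    of the [N] generators. *)
Lemma clique_word K g : clique K -> sub K g -> exists2 w, size w <= N & g = ev w.
Proof.
move=> cK [w0 w0K g0].
pose P n := `[< exists w, [/\ all (fun l => l.1 \in K) w, g = ev w & size w = n] >].
have ex : exists n, P n by exists (size w0); apply/asboolP; exists w0.
case: (ex_minnP ex) => n /asboolP[w [wK gw <-]] wmin; exists w => //.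
have rw : uniq (rots 1 w).
  apply: contraT => /rots_merge[w' [sw ew aw]].
  suff /wmin : P (size w') by rewrite leqNgt sw.
  by apply/asboolP; exists w'; rewrite ew; split=> //; exact: aw.
suff sub_rots : {subset rots 1 w <= [seq (x, gen x) | x <- enum 'I_N]}.
  have := uniq_leq_size rw sub_rots.
  by rewrite size_rots size_map size_enum_ord.
move=> k /mem_rots[u [b [v [wE kE]]]].
apply/mapP; exists k.1; first by rewrite mem_enum.
rewrite [k in LHS]surjective_pairing kE mul1g; congr pair.
move: wK; rewrite wE all_cat /= => /and3P[uK kK _].
suff uC : commute (gen k.1) (ev u) by rewrite -uC mulgK.
have: sub K (ev u) by exists u.
apply: sub_comm => i iK; have [->|ki] := eqVneq k.1 i; first exact: commute_refl.
exact/gen_comm/cK.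
Qed.

Lemma word_list n : exists s : seq W, forall w, size w <= n -> ev w \in s.
Proof.
elim: n => [|n [s sP]]; first by exists [:: 1] => -[]// _; rewrite ev_nil mem_head.
exists (1 :: [seq q.1 * q.2 | q <- [seq (g, h) |
  g <- [seq gen x ^+ a | x <- enum 'I_N, a <- iota 0 (m x)], h <- s]]).
case=> [_|[x a] w /= /sP ws]; first by rewrite ev_nil mem_head.
rewrite inE; apply/orP; right; apply/mapP; exists (gen x ^+ a, ev w); last by rewrite ev_cons.
apply: allpairs_f ws; rewrite -gen_mod.
apply/allpairsPdep; exists x, (a %% m x); split; rewrite ?mem_enum //.
by rewrite mem_iota /= add0n ltn_mod m_gt0.
Qed.

(** * Folding a path along a hyperplane *)

Lemma gen_eqZ x a b : (a%:R = b%:R :> 'Z_(m x))%R -> gen x ^+ a = gen x ^+ b.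
Proof.
move=> /(congr1 val) /=; rewrite !val_Zp_nat // => ab; exact: gen_eqmod.
Qed.

Lemma natZK x (c : 'Z_(m x)) : (nat_of_ord c)%:R%R = c.
Proof. exact: natr_Zp. Qed.

Lemma rotX h x n : (h * gen x * h^-1) ^+ n = h * gen x ^+ n * h^-1.
Proof.
have conjVE (y : W) : h * y * h^-1 = y ^ h^-1 by rewrite conjgE invgK mulgA.
by rewrite !conjVE conjXg.
Qed.

(* Moves every point to the sector [c] of a hyperplane by a rotation around it,
   so that edges crossing the hyperplane are collapsed. *)
Definition fold x h (c : 'Z_(m x)) u : W :=
  (h * gen x * h^-1) ^+ (c - sector x (h^-1 * u)%g)%R * u.

Fixpoint del k p (w : syl) : syl :=
  if w is l :: w' then
    let w'' := del k (p * gen l.1 ^+ l.2) w' in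
    if (l.1, p * gen l.1 * p^-1) == k then w'' else l :: w''
  else [::].

Lemma size_del k p w : size (del k p w) <= size w.
Proof.
elim: w p => //= l w IH p; case: ifP => _; last exact: IH.
exact: leq_trans (IH _) (leqnSn _).
Qed.

Lemma size_del_lt k p w : k \in rots p w -> size (del k p w) < size w.
Proof.
elim: w p => //= l w IH p; rewrite inE [k == _]eq_sym; case: eqP => [_ _|_ /= /IH //].
exact: size_del.
Qed.

(** Crossing the hyperplane raises the sector by the exponent of the syllable, which the rotation
    exponent in [fold] subtracts again; other edges keep their label. *)
Lemma fold_del x h (c : 'Z_(m x)) p w :
  fold h c p * ev (del (x, h * gen x * h^-1) p w) = fold h c (p * ev w).
Proof.
elim: w p => [|[y a] w IH] p /=; first by rewrite ev_nil !mulg1.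
rewrite ev_cons mulgA -IH; case: eqP => [[yx]|cr].
  rewrite {y}yx => pr; congr (_ * _).
  have hp : sub (star x) (h^-1 * p) by apply/sub_star_conj.
  have pE : p * gen x ^+ a = (h * gen x * h^-1) ^+ a * p by rewrite -pr rotX mulgVK.
  rewrite /fold (mulgA h^-1) sectorM eqxx (asboolT hp) andTb.
  rewrite pE mulgA -expgnDr !rotX; congr (_ * _ * _ * _).
  by apply: gen_eqZ; rewrite natrD !natZK opprD addrA subrK.
rewrite ev_cons mulgA; congr (_ * _); rewrite /fold (mulgA h^-1 p) sectorM -mulgA.
case: eqP => [yx|_]; last by rewrite andFb addr0.
rewrite {y}yx in cr *; case: asboolP => [hp|_]; last by rewrite andbF addr0.
by case: cr; congr pair; exact/esym/sub_star_conj.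
Qed.

(* A rotation that does not commute with the rotations of a hyperplane has its
   own hyperplane disjoint from it, so the carrier [g * sub (star i)] of the
   latter lies in one sector of the former. *)
Lemma sector_carrier x h i g k :
    ~ commute (h * gen x * h^-1) (g * gen i * g^-1) -> sub (star i) k ->
  sector x (h^-1 * (g * k)) = sector x (h^-1 * g).
Proof.
move=> nC sk; rewrite mulgA; have [//|[xi [w sw hw]]] := sector_coset x (h^-1 * g) sk.
case: nC; rewrite -mulgA in hw; move/sub_star_conj: hw => ->.
have -> : g * gen i * g^-1 = g * w * gen i * (g * w)^-1.
  by apply/sub_star_conj; rewrite mulKg.
exact/commute_conj/commute_sym/star_comm/sub_gen.
Qed.

(** With [g = h * t], the element [t^-1 * gen j * t] lies in [sub (star i)] and moves [t] to another
    sector of the hyperplane of [gen j], so the coset [t * sub (star i)] meets [sub (star j)]. *)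
Lemma carriers_meet i j g h : commute (g * gen i * g^-1) (h * gen j * h^-1) ->
  exists k l, [/\ sub (star i) k, sub (star j) l & g * k = h * l].
Proof.
have [t ->] : exists t, g = h * t by exists (h^-1 * g); rewrite mulVKg.
move=> C; have sw : sub (star i) (t^-1 * gen j * t).
  apply: centralizer_gen; have := commute_conj (h * t)^-1 C.
  by rewrite !invgM !invgK !mulgA !mulgVK mulVg mul1g.
have [|[_ [w siw sjw]]] := sector_coset j t sw; last by exists w, (t * w); rewrite mulgA.
rewrite !mulgA mulgV mul1g sector_starl; last exact/sub_gen/star_refl.
rewrite -[gen j]expg1 sector_genX => /eqP.
by rewrite -subr_eq0 addrK oner_eq0.
Qed.

(** * Short conjugators and finiteness of [Out W] *)

Definition connected_off_cliques : Prop :=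
  forall (K : {set 'I_N}) (f : 'I_N -> bool), clique K ->
    {in ~: K &, forall i j, e i j -> f i = f j} ->
    {in ~: K &, forall i j, f i = f j}.

(** For nonadjacent [i] and [j] the intersection is the set of common neighbours, so this excludes
    induced squares. *)
Definition common_nbrs_clique : Prop :=
  forall i j, i != j -> ~~ e i j -> clique (star i :&: star j).

Section ShortWords.
Hypotheses (sepW : connected_off_cliques) (sqW : common_nbrs_clique).
Variable phi : Aut W.

Let realizes (p : W) (w : 'I_N -> syl) : Prop :=
  forall i, phi (gen i) = p * ev (w i) * gen i * (p * ev (w i))^-1.

Lemma short_words (s : seq W) (sP : forall w, size w <= N -> ev w \in s) :
    (forall i, exists g, phi (gen i) = g * gen i * g^-1) ->
  exists p w, realizes p w /\ forall i, size (w i) <= N * size s.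
Proof.
move=> phi_gen.
pose total (w : 'I_N -> syl) := \sum_i size (w i).
have ex : exists n, `[< exists p w, realizes p w /\ total w = n >].
  have [g gP] := choice phi_gen.
  have /choice[w wP] i : exists w, g i = ev w by have [w _ ->] := sub_T (g i); exists w.
  exists (total w); apply/asboolP; exists 1, w; split=> // i.
  by rewrite mul1g -wP.
case: (ex_minnP ex) => n /asboolP[p [w [pw <-]]] wmin {n ex}.
(* Minimality of the total length in pointwise form: words nowhere longer are nowhere shorter. *)
have {}wmin p' w' : realizes p' w' -> (forall i, size (w' i) <= size (w i)) ->
    forall i, size (w i) <= size (w' i).
  move=> pw' w'w i; rewrite leqNgt; apply/negP => lti.
  suff : total w' < total w.
    by rewrite ltnNge wmin //; apply/asboolP; exists p', w'.
  rewrite /total (bigD1 i) //= [X in _ < X](bigD1 i) //= -addSn.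
  by apply: leq_add => //; apply: leq_sum => j _; exact: w'w.
exists p, w; split=> // i.
have rw : uniq (rots p (w i)).
  apply: contraT => /rots_merge[v [sv ev' _]].
  pose w' j := if j == i then v else w j.
  have pw' : realizes p w'.
    by move=> j; rewrite /w'; case: eqP => [->|_]; rewrite ?ev'; exact: pw.
  have w'w j : size (w' j) <= size (w j) by rewrite /w'; case: eqP => [->|//]; exact: ltnW.
  by have := wmin p w' pw' w'w i; rewrite /w' eqxx leqNgt sv.
suff sub_rots : {subset rots p (w i) <= [seq (x, phi y) | x <- enum 'I_N, y <- s]}.
  by have := uniq_leq_size rw sub_rots; rewrite size_rots size_allpairs size_enum_ord.
move=> [x r] xr; have [u [b [v [_ /= rE]]]] := mem_rots xr.
move: {u b v} (p * ev u) rE => h rE.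
pose g j := p * ev (w j).
pose C := [set j | `[< commute r (phi (gen j)) >]].
(* Adjacent generators have commuting images, so their carriers meet, and each carrier lies in one
   sector. *)
have sec_adj : {in ~: C &, forall j k, e j k -> sector x (h^-1 * g j) = sector x (h^-1 * g k)}.
  move=> j k; rewrite !inE => /asboolPn jC /asboolPn kC ejk.
  have := gen_comm ejk; rewrite -[_ = _]/(commute _ _) => /(aut_commute phi).
  move: jC kC; rewrite rE (pw j) (pw k) -/(g j) -/(g k) => jC kC /carriers_meet[j' [k' [sj sk jk]]].
  by rewrite -(sector_carrier jC sj) jk (sector_carrier kC sk).
have [cC|nC] := pselect (clique C).
  have sec_eq : {in ~: C &, forall j k, sector x (h^-1 * g j) = sector x (h^-1 * g k)}.
    move=> j k jC kC; apply/eqP.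
    have := sepW (f := fun l => sector x (h^-1 * g l) == sector x (h^-1 * g k)) cC _ jC kC.
    by rewrite eqxx => -> // j1 j2 j1C j2C /(sec_adj _ _ j1C j2C)->.
  have [c cP] : exists c : 'Z_(m x), forall j, j \notin C -> sector x (h^-1 * g j) = c.
    have [k kC|all] := pickP [pred k | k \notin C]; last by exists 0%R => j; have := all j => /= ->.
    by exists (sector x (h^-1 * g k)) => j jC; apply: sec_eq; rewrite inE.
  (* Folding fixes [g j] for [j] off [C]; on [C] it multiplies [g j] by a power of [r], which
     commutes with [phi (gen j)]. It shortens [w i]. *)
  have /wmin/(_ _ i) : realizes (fold h c p) (fun j => del (x, r) p (w j)).
    move=> j; rewrite rE fold_del -/(g j) /fold -rE.
    have [jC|/cP->] := boolP (j \in C); last by rewrite subrr expg0 mul1g; exact: pw.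
    move: jC; rewrite inE => /asboolP/commute_sym/(commuteX (c - sector x (h^-1 * g j)%g)%R).
    move: (r ^+ _) => z zC; suff -> : z * g j * gen j * (z * g j)^-1 = z * phi (gen j) * z^-1.
      by rewrite -zC mulgK.
    by rewrite (pw j) -/(g j) invgM !mulgA.
  by rewrite leqNgt size_del_lt // => /(_ (fun j => size_del _ _ _)).
have [j [k [jC kC jk njk]]] : exists j k, [/\ j \in C, k \in C, j != k & ~~ e j k].
  apply: contrapT => nE; apply: nC => j k jC kC jk; apply: contrapT => /negP njk.
  by apply: nE; exists j, k.
(* [psi r] centralizes [gen j] and [gen k], so it lies in the subgroup of their common neighbours, a
   clique, and hence in [s]. *)
have /= [psi _ psiK] := aut_bij phi.
have starC l : l \in C -> sub (star l) (psi r).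
  rewrite inE => /asboolP; rewrite -{1}[r]psiK => /aut_commute/commute_sym.
  exact: centralizer_gen.
have [v vN rv] := clique_word (sqW jk njk) (subI (starC j jC) (starC k kC)).
apply/allpairsPdep; exists x, (psi r); split; rewrite ?mem_enum ?psiK //.
by rewrite rv sP.
Qed.

End ShortWords.

(** The first key lists conjugates of the [phi (gen i)] in [s]; dividing by the chosen [rho t]
    leaves an automorphism conjugating each generator. The second key lists its short conjugators,
    which determine it up to the base point [p], that is, up to [Inn W]. *)
Lemma finite_Out : connected_off_cliques -> common_nbrs_clique -> finite_set (Out W).
Proof.
move=> sepW sqW; have [s sP] := word_list N.
have [s' s'P] := word_list (N * size s).
pose P1 (phi : Aut W) (t : {ffun 'I_N -> seq_sub s}) :=
  forall i, exists h, phi (gen i) ^ h = val (t i).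
pose P2 (phi : Aut W) (t : {ffun 'I_N -> seq_sub s'}) :=
  exists p, forall i, phi (gen i) = p * val (t i) * gen i * (p * val (t i))^-1.
have P1ex phi : exists t, P1 phi t.
  have tP i : exists t : seq_sub s, exists h, phi (gen i) ^ h = val t.
    have [|K [h [_ cK sK]]] := fin_order_conj (sub_T (phi (gen i))) (m_gt0 i).
      by rewrite -(morphXg _ (aut_morph phi)) gen_order (morph1g (aut_morph phi)).
    have [w wN gw] := clique_word cK sK.
    by exists (SeqSub (sP w wN)), h; rewrite gw.
  have [t tE] := choice tP; exists [ffun i => t i] => i.
  by rewrite ffunE; exact: tE.
have [rho rhoP] := witness_fun 1 P1.
have P2ex phi t : P1 phi t -> exists t', P2 ((rho t)^-1 * phi) t'.
  move=> pt; have rt := rhoP _ _ pt; set psi := _ * _.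
  have [i|p [w [pw wN]]] := short_words sepW sqW (phi := psi) sP.
    have [[h ph] [h' rh]] := (pt i, rt i).
    exists ((rho t)^-1 (h * h'^-1)).
    have -> : psi (gen i) = (rho t)^-1 (h * h'^-1 * rho t (gen i) * (h * h'^-1)^-1).
      congr ((rho t)^-1 _); apply: (conjg_inj h); rewrite ph -rh !conjgE.
      by rewrite !invgM !invgK !mulgA !mulgVK mulVg mul1g.
    move: (h * h'^-1) => a; rewrite !(aut_morph (rho t)^-1) (morphVg (aut_morph (rho t)^-1)).
    by rewrite [_ (rho t _)](aut_invK (rho t)).
  exists [ffun i => SeqSub (s'P (w i) (wN i))]; exists p => i.
  by rewrite ffunE.
apply: (@finite_Out_key W _ (fun phi k => P1 phi k.1 /\ P2 ((rho k.1)^-1 * phi) k.2)).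
  move=> phi; have [t pt] := P1ex phi; have [t' pt'] := P2ex _ _ pt.
  by exists (t, t').
move=> phi psi [t t'] /= [_ [p pP]] [_ [q qP]].
pose f := (rho t)^-1 * phi; pose f' := (rho t)^-1 * psi.
(* Composing [f'] with this inner automorphism conjugates its values by [p * q^-1], replacing the
   base point [q] by [p]. *)
exists (f'^-1 (p * q^-1)); apply: (mulgI (rho t)^-1); rewrite mulgA -/f -/f'.
apply: autP; apply: gp_hom_eq (aut_morph f) (aut_morph _) _ => i.
rewrite pP aut_innerE [f' (f'^-1 _)](aut_Kinv f') qP.
by rewrite !invgM !invgK !mulgA !mulgVK.
Qed.

(** * One-ended graph products *)

Lemma sub_genP A x : sub A (gen x) -> x \in A.
Proof.
move=> sx; apply: contraT => xA.
have [|[]//] := sector_coset x 1 sx; last by rewrite (negbTE xA).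
by rewrite mul1g -[gen x]expg1 sector_genX sector1 => /eqP; rewrite oner_eq0.
Qed.

Lemma alt_const x k g : (gen x * g) ^+ k = alt x (nseq k (1%N, g)).
Proof. by elim: k => [|k IH]; rewrite ?expg0 ?alt_nil //= alt_cons expgS IH expg1. Qed.

Lemma alt_reduced_nseq x y k : x != y -> ~~ e x y ->
  {in nseq k (1%N, gen y), forall l, alt_reduced x l}.
Proof.
move=> xy nxy l /nseqP[-> _]; split=> /=; first by rewrite dvdn1 gtn_eqF.
  by apply: sub_gen; rewrite !inE eq_sym.
by move=> /sub_genP; rewrite inE eq_sym (negbTE xy) (negbTE nxy).
Qed.

Lemma dihedral_notin_star x y k : x != y -> ~~ e x y ->
  ~ sub (star x) ((gen x * gen y) ^+ k.+1).
Proof.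
move=> xy nxy; rewrite alt_const; have [||] // := @alt_reducedP x (nseq k.+1 (1%N, gen y)).
exact: alt_reduced_nseq.
Qed.

Lemma dihedral_inj x y : x != y -> ~~ e x y -> injective (fun k => (gen x * gen y) ^+ k).
Proof.
move=> xy nxy; have ltE k l : k < l -> (gen x * gen y) ^+ k <> (gen x * gen y) ^+ l.
  move=> kl; rewrite -(subnKC (ltnW kl)) expgnDr -{1}[_ ^+ k]mulg1 => /mulgI.
  have := @dihedral_notin_star x y (l - k).-1 xy nxy.
  by rewrite prednK ?subn_gt0 // => + E; rewrite -E => -[]; exact: sub1.
by move=> k l kl; case: (ltngtP k l) => // /ltE; [|move/nesym]; case.
Qed.

(** As [K] misses [x] and [y], [sub K] meets [sub [set x; y]] trivially. *)
Lemma dihedral_off_clique K x y : x != y -> ~~ e x y -> x \notin K -> y \notin K ->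
  (forall k, ~ sub K ((gen x * gen y) ^+ k.+1)) /\
  (forall k, ~ sub K ((gen x * gen y) ^+ k * gen x)).
Proof.
move=> xy nxy xK yK.
have sK g : sub K g -> sub [set x; y] g -> sub (star x) g.
  move=> /subI H /H; apply: subS; apply/fintype.subsetP => z.
  by rewrite !inE => /andP[zK /orP[]/eqP zE]; rewrite zE (negbTE xK, negbTE yK) in zK.
have sD k : sub [set x; y] ((gen x * gen y) ^+ k).
  elim: k => [|k IH]; first exact: sub1.
  by rewrite expgSr; apply: subM => //; apply: subM; apply: sub_gen; rewrite !inE eqxx ?orbT.
split=> k; first by move=> /sK/(_ (sD _)); exact: dihedral_notin_star.
case: k => [|k] kK; first by move: kK; rewrite expg0 mul1g => /sub_genP; rewrite (negbTE xK).
apply: (@dihedral_notin_star x y k xy nxy); apply/(subMr _ (sub_gen (star_refl x))).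
by apply: (sK _ kK); apply: subM => //; apply: sub_gen; rewrite !inE eqxx.
Qed.

(** If [K] separates [a] from [b], the cocycle [chi] counts passages into and out of the finite
    group [sub K] along edges labelled in the side [B] of [b]. Its zero set is almost invariant,
    contains the powers of [gen a * gen b] and misses the positive powers of [gen b * gen a]. *)
Lemma one_ended_connected : one_ended W -> connected_off_cliques.
Proof.
move=> [S genS ends1] K f cK f_adj a b aK bK; apply/eqP/negPn/negP => fab.
rewrite !inE in aK bK.
pose B := [set y | (y \notin K) && (f y != f a)].
pose iota g : int := if `[< sub K g >] then 1%R else 0%R.
pose c g y : int := (if y \in B then iota (g * gen y)%g - iota g else 0)%R.
have iotaK g y : y \in K -> iota (g * gen y) = iota g.
  by move=> yK; rewrite /iota (asbool_equiv_eq (subMr g (sub_gen yK))).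
have [|g i j eij|chi [chiM chiE]] := @cocycle_ex _ c.
- move=> g y; rewrite /c; case: (y \in B); last by rewrite big1.
  have := telescope_sumr (fun k => iota (g * gen y ^+ k)) (leq0n (m y)).
  rewrite big_mkord gen_order expg0 !mulg1 subrr => tel.
  rewrite -[RHS]tel; by apply: eq_bigr => k _; rewrite -mulgA -expgSr.
(* A neighbour of [B] outside [B] lies in [K], and right multiplication by its generator preserves
   [iota]. *)
- have swap y z : e y z -> y \in B -> z \notin B ->
      (c g y + c (g * gen y)%g z = c g z + c (g * gen z)%g y)%R.
    move=> eyz yB zB; rewrite /c yB (negbTE zB) addr0 add0r -mulgA.
    have zK : z \in K.
      move: yB zB; rewrite !inE => /andP[yK fy]; apply: contraNT => zK.
      by rewrite zK -(f_adj y z) // !inE.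
    by rewrite -(gen_comm eyz) mulgA !(iotaK _ _ zK).
  have [iB|iB] := boolP (i \in B); have [jB|jB] := boolP (j \in B).
  + have tel (x y z : int) : (x - z + (y - x) = y - z)%R by rewrite addrC addrA subrK.
    by rewrite /c iB jB !tel -!mulgA (gen_comm eij).
  + exact: swap.
  + by apply/esym/swap; rewrite // e_sym.
  + by rewrite /c (negbTE iB) (negbTE jB).
have chi1 : chi 1 1 = 0%R.
  by have := chiM 1 1 1; rewrite mulg1 -[LHS]addr0 => /addrI.
have chi_gen g y : chi 1 (g * gen y) = (chi 1%g g + c g y)%R by rewrite chiM mul1g chiE.
have [t tP] : exists t : seq W, forall g, sub K g -> g \in t.
  have [t tP] := word_list N; exists t => g /(clique_word cK)[w wN ->]; exact: tP.
have bB : b \in B by rewrite inE bK eq_sym.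
have aB : a \notin B by rewrite inE aK eqxx.
have ab : a != b by apply: contraNneq fab => ->.
have nab : ~~ e a b by apply: contraNN fab => /f_adj->; rewrite ?inE.
have iota0 g : ~ sub K g -> iota g = 0%R by move=> /asboolF; rewrite /iota => ->.
apply: (@almost_invariant_ends _ S genS (fun g => chi 1 g == 0%R) ends1).
- apply: gp_ind => [|h y k finh].
    by rewrite (_ : mkset _ = set0) //; apply/seteqP; split=> g //=; rewrite mulg1 eqxx.
  elim: k => [|k IH] in h finh *; first by rewrite expg0 mulg1.
  rewrite expgS mulgA; apply: IH.
  (* The extra step by [gen y] alters [chi] only if one of its ends lies in [sub K], hence in
     [t]. *)
  pose T := ((fun g => g * h) @^-1` ([set` t] `|` (fun g => g * gen y) @^-1` [set` t]))%classic.
  apply: (@sub_finite_set _ _ ([set g | (chi 1 g == 0%R) != (chi 1 (g * h) == 0%R)] `|` T)%classic).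
    move=> g /=; rewrite mulgA chi_gen => Eg.
    have [E1|E1] := eqVneq ((chi 1 g == 0%R)) (chi 1 (g * h) == 0%R); [right|by left].
    rewrite E1 in Eg; apply: contrapT => /not_orP[/= gt gyt]; move/eqP: Eg; apply.
    rewrite /c; case: ifP => _; last by rewrite addr0.
    by rewrite !iota0 ?subrr ?addr0 // => /tP.
  rewrite finite_setU; split=> //; apply: finite_preimage; first exact: in2W (mulIg h).
  rewrite finite_setU; split; first exact: finite_seq.
  by apply: finite_preimage (finite_seq t); exact: in2W (mulIg _).
- apply: infinite_inj (dihedral_inj ab nab) _ => k /=; apply/eqP.
  have [offK offK'] := dihedral_off_clique ab nab aK bK.
  elim: k => [|k IH]; first by rewrite expg0.
  rewrite expgSr mulgA 2!chi_gen IH /c (negbTE aB) bB -mulgA -expgSr.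
  by rewrite !iota0 ?subrr ?addr0.
- have ba : b != a by rewrite eq_sym.
  have nba : ~~ e b a by rewrite e_sym.
  have [offK offK'] := dihedral_off_clique ba nba bK aK.
  (* The power [0] has [chi] equal to [0] and is skipped; the first letter leaves [sub K] through
     [B], and the path never returns. *)
  apply: infinite_inj (inj_comp (dihedral_inj ba nba) succn_inj) _ => k /=.
  suff -> : chi 1 ((gen b * gen a) ^+ k.+1) = (-1)%R by [].
  elim: k => [|k IH]; rewrite expgSr mulgA 2!chi_gen.
    rewrite expg0 chi1 /c (negbTE aB) bB add0r addr0 iota0; last exact: (offK' 0).
    by rewrite /iota asboolT //; exact: sub1.
  by rewrite IH /c (negbTE aB) bB !iota0 ?subrr ?addr0.
Qed.

(** * Hyperbolic graph products *)

Lemma rots_sector x h p w : (x, h * gen x * h^-1) \notin rots p w ->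
  sector x (h^-1 * (p * ev w)) = sector x (h^-1 * p).
Proof.
elim: w p => [|[y a] w IH] p /=; first by rewrite ev_nil mulg1.
rewrite inE negb_or => /andP[hp /IH]; rewrite ev_cons !mulgA => ->.
rewrite sectorM; case: eqP => [yx|_]; last by rewrite andFb addr0.
case: asboolP => [hs|_]; last by rewrite andbF addr0.
by case/eqP: hp; rewrite yx; congr pair; apply/sub_star_conj.
Qed.

(* The hyperplanes dual to the edges labelled [x] of the axis of
   [gen x * gen y] all have to be crossed. *)
Lemma dihedral_size x y p u w : x != y -> ~~ e x y -> sub (~: [set x]) u ->
  ev w = (gen x * gen y) ^+ p * u -> p <= size w.
Proof.
move=> xy nxy ux wE; pose h k := (gen x * gen y) ^+ k.
have hV k : sector x (h k)^-1 = 0%R.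
  elim: k => [|k IH]; first by rewrite /h expg0 invg1 sector1.
  rewrite /h expgS !invgM !mulgA -/(h k).
  rewrite !genV sectorM eqxx sectorM IH eq_sym (negbTE xy) andFb addr0 add0r.
  case: asboolP => // /subV; rewrite -genV -invgM invgK => sy.
  case: (@dihedral_notin_star x y k xy nxy).
  by rewrite expgS -mulgA; apply: subM sy; exact/sub_gen/star_refl.
have hh k l : k <= l -> (h k)^-1 * h l = h (l - k).
  by move=> kl; rewrite /h -{1}(subnKC kl) expgnDr mulKg.
pose J k := (x, h k * gen x * (h k)^-1).
have J_inj : injective J.
  have ltJ k l : k < l -> J k <> J l.
    move=> kl [/sub_star_conj]; rewrite hh ?(ltnW kl) // /h -(prednK (n := l - k)) ?subn_gt0 //.
    exact: dihedral_notin_star.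
  by move=> k l kl; case: (ltngtP k l) => // /ltJ; [|move/nesym]; case.
have uJ : uniq [seq J k | k <- iota 0 p] by rewrite map_inj_uniq ?iota_uniq.
suff /(uniq_leq_size uJ) : {subset [seq J k | k <- iota 0 p] <= rots 1 w}.
  by rewrite size_map size_iota size_rots.
move=> _ /mapP[k + ->]; rewrite mem_iota add0n => /= kp; apply: contraT => /rots_sector.
rewrite mul1g mulg1 hV wE -/(h p) mulgA hh ?(ltnW kp) // sector_subC1 // /h alt_const.
have [||-> _] := @alt_reducedP x (nseq (p - k) (1%N, gen y)).
- by rewrite -size_eq0 size_nseq -lt0n subn_gt0.
- exact: alt_reduced_nseq.
have -> : head (0%N, 1) (nseq (p - k) (1%N, gen y)) = (1%N, gen y).
  by rewrite -(prednK (n := p - k)) ?subn_gt0.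
by move=> /eqP; rewrite oner_eq0.
Qed.

(** [c] exceeds the lengths of chosen syllable words for the elements of [S] and their inverses. *)
Lemma ev_word_length (S : seq W) : generates S -> exists2 c, 0 < c &
  forall g, exists2 w, ev w = g & size w <= c * word_length S g.
Proof.
move=> genS; have /choice[r rP] g : exists w, ev w = g.
  by have [w _ ->] := sub_T g; exists w.
pose c := (\max_(s <- S) maxn (size (r s)) (size (r s^-1))).+1.
exists c => // g; have [w [wS <-] <-] := word_length_ex genS g.
elim: w wS => [|[s b] w IH]; first by exists [::]; rewrite // ev_nil /weval big_nil.
move=> /= /andP[sS /IH[v vE vw]].
exists (r (if b then s^-1 else s) ++ v); first by rewrite ev_cat rP vE /weval big_cons.
rewrite size_cat mulnS leq_add // /c leqW //.
apply: (leq_trans _ (leq_bigmax_seq _ sS _)) => //.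
by case: b; rewrite leq_max leqnn ?orbT.
Qed.

(** An induced square [i, k, j, l] yields commuting [a] and [b]. Any path in their flat crosses the
    hyperplanes along both axes, so the flat is undistorted. *)
Lemma hyperbolic_common_nbrs : word_hyperbolic W -> common_nbrs_clique.
Proof.
move=> [S genS [delta hyp]] i j ij nij k l.
rewrite !inE => /andP[ki kj] /andP[li lj] kl; apply/negPn/negP => nkl.
have off z t u : z != t -> ~~ e z t -> (u == z) || e z u -> (u == t) || e t u ->
    u != z /\ e z u.
  move=> zt nzt uz ut; have uz' : u != z.
    apply: contraNneq nzt => uzE; move: ut.
    by rewrite uzE (negbTE zt) /= e_sym.
  by move: uz; rewrite (negbTE uz').
have [ki' eik] := off _ _ _ ij nij ki kj; have [li' eil] := off _ _ _ ij nij li lj.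
have ji : j != i by rewrite eq_sym.
have nji : ~~ e j i by rewrite e_sym.
have [kj' ejk] := off _ _ _ ji nji kj ki; have [lj' ejl] := off _ _ _ ji nji lj li.
have [c c0 cP] := ev_word_length genS.
pose a := gen i * gen j; pose b := gen k * gen l.
have ab : commute a b.
  by apply: commute_sym; apply: commuteM; apply: commute_sym; apply: commuteM;
    exact: gen_comm.
have bP q : sub (~: [set i]) (b ^+ q).
  elim: q => [|q IH]; first exact: sub1.
  by rewrite expgSr; apply: subM => //; apply: subM; apply: sub_gen; rewrite !inE.
have aP q : sub (~: [set k]) (a ^+ q).
  elim: q => [|q IH]; first exact: sub1.
  by rewrite expgSr; apply: subM => //; apply: subM; apply: sub_gen; rewrite !inE eq_sym.
apply: (hyperbolic_no_flat genS hyp ab c0) => p q p' q' le.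
  have [w wE wS] := cP ((a ^+ p * b ^+ q)^-1 * (a ^+ p' * b ^+ q')).
  apply: leq_trans wS; apply: (dihedral_size (u := b ^- q * b ^+ q') ij nij).
    by apply: subM => //; apply: subV.
  rewrite wE -/a -{1}(subnKC le) expgnDr invgM -!mulgA mulKg !mulgA; congr (_ * _).
  exact/commute_sym/commuteV/commuteX2/commute_sym.
have [w wE wS] := cP ((a ^+ p * b ^+ q)^-1 * (a ^+ p' * b ^+ q')).
apply: leq_trans wS; apply: (dihedral_size (u := a ^- p * a ^+ p') kl nkl).
  by apply: subM => //; apply: subV.
have zb n : commute (a ^- p * a ^+ p') (b ^+ n).
  by apply: commute_sym; apply: commuteM; [apply: commuteV|]; apply/commuteX2/commute_sym.
rewrite wE -/b invgM -{1}(subnKC le) expgnDr !mulgA -(mulgA (b ^- q)).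
by rewrite -(mulgA (b ^- q)) zb mulKg zb mulgA.
Qed.

End GraphProduct.

Theorem corollary8p1 (N : nat) (hN : (0 < N)%N) (e : rel 'I_N)
    (e_sym : symmetric e) (e_irr : irreflexive e)
    (m : 'I_N -> nat) (m_pp : forall i, prime_power (m i)) :
  one_ended (graph_product e m) ->
  word_hyperbolic (graph_product e m) ->
  finite_set (Out (graph_product e m)).
Proof.
have m_gt1 i : 1 < m i.
  have [p [a [p_pr a_gt0 ->]]] := m_pp i.
  by rewrite -(exp1n a) ltn_exp2r // prime_gt1.
move=> /(one_ended_connected e_sym m_gt1) sepW /(hyperbolic_common_nbrs e_sym m_gt1) sqW.
exact: finite_Out.
Qed.
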